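(* Let $(M,\rho)$ be a countably infinite compact metric space, let $X=\prod_{-\infty}^{+\infty}M$ be endowed with the metric $$d(x,y)=\sum_{n\in\mathbb{Z}}\min\left\{\frac{1}{a_{|n|}+1},\rho(x_n,y_n)\right\},$$ where $(a_n)_{n\ge0}$ is any monotone increasing sequence of nonnegative real numbers such that $\sum_{k\ge0}\frac{1}{a_k+1}<\infty$ and, for each $\alpha>0$, $\lim_{k\to\infty}\frac{a_k}{e^{\alpha k}}=0$. Let $T:X\to X$ be the full-shift and let $\mathcal{M}(T)$ be the space of $T$-invariant Borel probability measures on $X$ with the weak topology. Then: 1. for each $q>1$, the set $\{\mu\in\mathcal{M}(T)\mid D^+_\mu(q)=+\infty\}$ is a dense $G_\delta$ subset of $\mathcal{M}(T)$; 2. the set $\{\mu\in\mathcal{M}(T)\mid D^+_\mu(1)=+\infty\}$ is a residual subset of $\mathcal{M}(T)$.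
   Context: $X=M^{\mathbb{Z}}$ is the bilateral product of copies of $M$; the given metric is compatible with the product topology. The full-shift is $Tx=y$ with $y_i=x_{i-1}$ for each $i\in\mathbb{Z}$. The weak topology on $\mathcal{M}(T)$ is the one for which $\mu_\alpha\to\mu$ if and only if $\int f\,d\mu_\alpha\to\int f\,d\mu$ for every bounded continuous $f$. A subset of a topological space is residual if it contains a countable intersection of open dense sets. For a Borel probability measure $\mu$ on $X$, $q\ne1$ and $\varepsilon\in(0,1)$, let $I_\mu(q,\varepsilon)=\int_{\operatorname{supp}(\mu)}\mu(B(x,\varepsilon))^{q-1}d\mu(x)$, where $\operatorname{supp}(\mu)$ is the topological support of $\mu$ and $B(x,\varepsilon)$ is the open ball. The upper $q$-generalized fractal dimension of $\mu$ (for $q>0$, $q\neq1$) is $D^+_\mu(q)=\limsup_{\varepsilon\downarrow0}\frac{\log I_\mu(q,\varepsilon)}{(q-1)\log\varepsilon}\in[0,+\infty]$, and the upper entropy dimension is $D^+_\mu(1)=\limsup_{\varepsilon\downarrow0}\frac{\int_{\operatorname{supp}(\mu)}\log\mu(B(x,\varepsilon))\,d\mu(x)}{\log\varepsilon}$. *)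

(* Defs.v *)
From HB Require Import structures.
From mathcomp Require Import all_boot all_order all_algebra.
From mathcomp Require Import all_classical all_reals all_analysis.
From mathcomp Require Import borel_hierarchy.

Set Implicit Arguments.
Unset Strict Implicit.
Unset Printing Implicit Defensive.

Import Order.TTheory GRing.Theory Num.Theory.
Import numFieldNormedType.Exports.

Local Open Scope classical_set_scope.
Local Open Scope ring_scope.

(* Measurable types are pointed in the library, so a base point is carried
   along with the metric; it is never used otherwise. *)
#[short(type="pmetricType")]
HB.structure Definition PMetric (K : numDomainType) :=
  {M of Pointed M & Metric K M}.

Definition shift_space (M : Type) : Type := int -> M.

HB.instance Definition _ (M : ptopologicalType) :=
  Topological.copy (shift_space M) {ptws int -> M}.
HB.instance Definition _ (M : ptopologicalType) :=
  isPointed.Build (shift_space M) (fun=> point).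

Section borel.
Variable M : ptopologicalType.
Let B : set_system (shift_space M) := <<s open >>.

Let B0 : B set0. Proof. exact: sigma_algebra0. Qed.

Let BC A : B A -> B (~` A). Proof. exact: sigma_algebraC. Qed.

Let BU (F : (set (shift_space M))^nat) : (forall i, B (F i)) ->
  B (\bigcup_i F i).
Proof. exact: sigma_algebra_bigcup. Qed.

HB.instance Definition _ :=
  @isMeasurable.Build (sigma_display (@open (shift_space M)))
    (shift_space M) B B0 BC BU.
End borel.

Definition full_shift (M : Type) (x : shift_space M) : shift_space M :=
  fun i => x (i - 1).

(* The summands are nonnegative, so the unordered sum over int has a value in
   [0, +oo]; it is finite as soon as 1 / (a_k + 1) is summable. *)
Definition shift_dist (R : realType) (M : pmetricType R) (a : R^nat)
    (x y : shift_space M) : \bar R :=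
  \esum_(n in [set: int])
    (Num.min (a `|n|%N + 1)^-1 (mdist (x n) (y n)))%:E.

Definition shift_ball (R : realType) (M : pmetricType R) (a : R^nat)
    (x : shift_space M) (e : R) : set (shift_space M) :=
  [set y | (shift_dist a x y < e%:E)%E].

(* Two elements agreeing on Borel sets may differ as functions on non-Borel
   sets. They are then topologically indistinguishable for the weak topology
   below, so density, G-delta and residual sets are not affected. *)
Record invariant_probability (R : realType) (M : pmetricType R) := InvProb {
  invprob_val :> probability (shift_space M) R ;
  _ : forall A : set (shift_space M), measurable A ->
        invprob_val (@full_shift M @^-1` A) = invprob_val A }.

HB.instance Definition _ (R : realType) (M : pmetricType R) :=
  gen_eqMixin (invariant_probability M).
HB.instance Definition _ (R : realType) (M : pmetricType R) :=
  gen_choiceMixin (invariant_probability M).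

Definition bounded_continuous (R : realType) (M : pmetricType R) : Type :=
  {f : shift_space M -> R | continuous f /\ bounded_fun f}.

Definition integral_eval (R : realType) (M : pmetricType R)
    (mu : invariant_probability M) : {ptws bounded_continuous M -> R} :=
  fun f => \int[mu]_x sval f x.

(* The weak topology: the coarsest one making every mu |-> \int f dmu, with f
   bounded continuous, continuous. *)
HB.instance Definition _ (R : realType) (M : pmetricType R) :=
  Topological.copy (invariant_probability M)
    (initial_topology (@integral_eval R M)).

Definition msupp (R : realType) (M : pmetricType R)
    (mu : invariant_probability M) : set (shift_space M) :=
  [set x | forall U, open U -> U x -> (0 < mu U)%E].

Section dimensions.
Local Open Scope ereal_scope.
Variables (R : realType) (M : pmetricType R) (a : R^nat).
Implicit Types (mu : invariant_probability M) (q e : R).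

Definition ball_moment mu q e : \bar R :=
  \int[mu]_(x in msupp mu) (mu (shift_ball a x e) `^ (q - 1)).

(* The limsup is along e -> 0 with e > 0, so only e < 1, where ln e != 0,
   matters. *)
Definition upper_fractal_dim mu q : \bar R :=
  limf_esup (fun e => lne (ball_moment mu q e) / ((q - 1) * ln e)%:E) 0^'+.

Definition upper_entropy_dim mu : \bar R :=
  limf_esup (fun e =>
    (\int[mu]_(x in msupp mu) lne (mu (shift_ball a x e))) / (ln e)%:E) 0^'+.

End dimensions.

Definition residual (T : topologicalType) (S : set T) :=
  exists2 G : set T, Gdelta_dense G & G `<=` S.

(* Main.v *)
Require Import Defs.
From HB Require Import structures.
From mathcomp Require Import all_boot all_order all_algebra.
From mathcomp Require Import all_classical all_reals all_analysis.
From mathcomp Require Import borel_hierarchy measurable_realfun.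
From mathcomp Require Import lra ring zify.

Import Order.TTheory GRing.Theory Num.Theory.
Import numFieldNormedType.Exports.

Local Open Scope classical_set_scope.
Local Open Scope ring_scope.

(** The alphabet [M] is countable, so it has a countable base of clopen sets, and so has the
compact space [X]. Agreement on the first [K] cylinders of the base cuts [X] into finitely
many clopen cells, and these cells shrink uniformly as [K] grows. Balls can therefore be
replaced by finite unions of cells, at the price of changing the radius by a factor two.

Infinite dimension is a G-delta condition. Let the clopen set [V l] contain [B(x, e)] and be
contained in [B(x, 2 e)] for every [x] in the cell [l]. The sum over [l] of
[mu (cell l) * mu (V l) ^ (q - 1)] then lies between [I_mu(q, e)] and [I_mu(q, 2 e)]. It is
continuous in [mu] for the weak topology, because the indicator of a clopen set is a bounded
continuous function. The dimension of order [q > 1] is infinite if and only if for each [n]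
such a sum at some scale [e < 1 / (n + 1)] is less than [e ^ (n (q - 1))], and for fixed [n]
this is an open condition on [mu] ([upper_fractal_dim_pinfty_Gdelta]).

Infinite dimension is a dense condition. Given an invariant measure [mu], choose finitely
many points whose empirical measure is close to [mu] on a fine partition, cut a long orbit
block out of each of them, and concatenate the blocks into a word of length [L]. Repeat the
word over the whole line, but let a fair coin write one of two distinct letters [p], [p'] at
every [L]-th place, and average the law of the resulting point over the [L] phases. Whatever
the coins show, averages along the orbit over a period are close to integrals against [mu]
([coded_approximation]), so that the invariant measure obtained is close to [mu]. A ball of
radius [e <= mdist p p' / 2] determines every coordinate [n] with [e <= 1 / (a_n + 1)] well
enough to read its coin; there are [h] coins within distance [h L], so the ball has measure at
most [2 ^ (- h)] as soon as [e <= 1 / (a_(h L) + 1)] ([coded_average_ball]). Since [a] grows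
subexponentially, [h] can exceed any prescribed multiple of [log (1 / e)], which makes the
dimension of order [q] infinite for every [q > 1] ([coded_upper_fractal_dim]). The coins are
the binary digits of a uniform point of the unit interval.

For the entropy dimension, concavity of the logarithm bounds the integral of
[ln (mu (B(x, e)))] by the logarithm of the sum above with [q = 2]
([entropy_le_ln_cells]). Hence the measures with infinite dimension of order 2, which form a
dense G-delta set, have infinite entropy dimension. *)

(** * Clopen bases of countable metric spaces *)
Lemma exists_invn_lt {R : archiRealFieldType} (e : R) : 0 < e ->
  exists n : nat, n.+1%:R^-1 < e.
Proof.
move=> e0; exists (Num.trunc e^-1).
by rewrite -[ltRHS]invrK ltf_pV2 ?posrE ?invr_gt0// truncnS_gt.
Qed.

Section clopen_base.
Context {R : realType} {M : pmetricType R}.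
Hypothesis M_countable : countable [set: M].

(** The distances from [x] form a countable set, while an interval has positive length. For a
radius that is no distance from [x] the sphere is empty, so that the ball is clopen. *)
Lemma avoids_distances (x : M) (e : R) : 0 < e ->
  exists2 r : R, 0 < r < e & forall y, mdist x y != r.
Proof.
move=> e0; apply: contrapT => /forall2NP H.
have sub : `]0, e[%classic `<=` (mdist x) @` [set: M].
  move=> r /=; rewrite in_itv /= => re.
  have [//|] := H r; move/existsNP => [y /negP]; rewrite negbK => /eqP yr.
  by exists y.
have c : countable `]0, e[%classic.
  apply: sub_countable (subset_card_le sub) _.
  exact: sub_countable (card_image_le _ _) M_countable.
have := countable_lebesgue_measure0 c.
rewrite lebesgue_measure_itv /= lte_fin e0 sube0 => -[] /eqP.
by rewrite gt_eqF.
Qed.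

Lemma clopen_neighbourhood (x : M) (e : R) : 0 < e ->
  exists A : set M, [/\ clopen A, A x & forall y, A y -> mdist x y < e].
Proof.
move=> e0; have [r /andP[r0 re] rE] := avoids_distances x e e0.
exists (ball x r); split; [split|exact: ballxx|].
- rewrite openE => y; rewrite ballEmdist /= => xy.
  rewrite /interior -nbhs_ballE /nbhs_ball_ /filter_from /=.
  exists (r - mdist x y); first by rewrite /= subr_gt0.
  move=> z; rewrite !ballEmdist /= => yz.
  by rewrite (le_lt_trans (metric_triangle x y z))// addrC -ltrBrDr.
- rewrite -openC openE => y /=; rewrite ballEmdist /= => /negP xy.
  rewrite /interior -nbhs_ballE /nbhs_ball_ /filter_from /=.
  have rxy : r < mdist x y by rewrite lt_neqAle eq_sym rE leNgt.
  exists (mdist x y - r); first by rewrite /= subr_gt0.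
  move=> z; rewrite !ballEmdist /= => yz.
  apply/negP; rewrite -leNgt.
  have := metric_triangle x z y; rewrite (metric_sym z y) => h.
  by lra.
- by move=> y; rewrite ballEmdist /= => /lt_trans; exact.
Qed.

(** One clopen neighbourhood of diameter of order [1 / (k + 1)] for each pair of a point and an
integer [k]. The index of a set is the code of its pair; an index that codes nothing gets the
whole space, which is clopen. *)
Lemma countable_clopen_base : exists A : nat -> set M,
  (forall j, clopen (A j)) /\
  forall x U, nbhs x U -> exists j, A j x /\ A j `<=` U.
Proof.
have ex (p : M * nat) : exists A : set M,
    [/\ clopen A, A p.1 & forall y, A y -> mdist p.1 y < p.2.+1%:R^-1].
  by apply: clopen_neighbourhood; rewrite invr_gt0.
have [B HB] := choice ex.
have [f finj] : exists f : M -> nat, {in [set: M] &, injective f}.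
  by move/countable_injP : M_countable => [f]; exists f.
pose P j (p : M * nat) := pickle (f p.1, p.2) = j.
exists (fun j => if pselect (exists p, P j p) is left h then
   B (projT1 (cid h)) else setT); split => [j|x U].
  case: pselect => [h|_]; last by split; [exact: openT|exact: closedT].
  by case: (HB (projT1 (cid h))).
rewrite -nbhs_ballE => -[e /= e0 eU].
have [k ke] := exists_invn_lt e e0.
exists (pickle (f x, k)); case: pselect => [h|]; last first.
  by move=> []; exists (x, k).
case: (cid h) => -[y l] /= /(pcan_inj pickleK)[fyx ->].
have -> : y = x by apply: finj => //; rewrite inE.
have [_ Bx Be] := HB (x, k); split => // z /Be /= xz.
by apply: eU; rewrite /= ballEmdist /=; exact: lt_trans ke.
Qed.

End clopen_base.

(** * Cells of the shift space *)
(** The topology of pointwise convergence is the coarsest one with continuous coordinates. *)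
Lemma ptws_cvg {I : Type} {T : topologicalType}
    (F : set_system {ptws I -> T}) (f : {ptws I -> T}) : Filter F ->
  (forall i, (fun g : {ptws I -> T} => g i) @ F --> f i) -> F --> f.
Proof.
move=> FF H; apply/cvg_sup => i U [V] [[W] oW <-] WfN WU.
by apply: (filterS WU); rewrite nbhs_simpl; apply: (H i); exact: open_nbhs_nbhs.
Qed.

Lemma ptws_eval_continuous {I : Type} {T : topologicalType} (i : I) :
  continuous (fun g : {ptws I -> T} => g i).
Proof.
move=> g U gU; have /cvg_sup/(_ i) h : g --> g by exact: cvg_id.
apply: h; exact: (@initial_continuous _ _ (fun g : I -> T => g i) g U gU).
Qed.

Lemma coordinate_continuous {T : ptopologicalType} (n : int) :
  continuous (fun x : shift_space T => x n).
Proof. exact: (@ptws_eval_continuous int T n). Qed.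

Section cylinders.
Context {R : realType} {M : pmetricType R}.
Notation X := (shift_space M).
Hypothesis M_compact : compact [set: M].

Lemma shift_space_compact : compact [set: X].
Proof.
have := @tychonoff _ (fun _ : int => M : topologicalType) _ (fun=> M_compact).
by congr (compact _); apply/seteqP; split.
Qed.

Variable A : nat -> set M.
Hypothesis A_clopen : forall j, clopen (A j).
Hypothesis A_base : forall x U, nbhs x U -> exists j, A j x /\ A j `<=` U.

(** All pairs of a coordinate and a base set are listed in one sequence, so that a single
level [K] controls both how many coordinates are read and how precisely. *)
Definition cylinder (m : nat) : set X :=
  if unpickle m is Some (n, j) then [set x | A j (x n)] else setT.

(** The classes of this relation are the cells of level [K]. They are nested as [K] grows. *)
Definition same_cell (K : nat) (x y : X) : Prop :=
  forall m, (m < K)%N -> cylinder m x <-> cylinder m y.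

Lemma same_cell_refl K x : same_cell K x x. Proof. by []. Qed.

Lemma same_cell_sym K x y : same_cell K x y -> same_cell K y x.
Proof. by move=> h m /h[]. Qed.

Lemma same_cell_trans K x y z : same_cell K x y -> same_cell K y z -> same_cell K x z.
Proof. by move=> xy yz m mK; apply: iff_trans (xy _ mK) (yz _ mK). Qed.

Lemma same_cellW K K' x y : (K <= K')%N -> same_cell K' x y -> same_cell K x y.
Proof. by move=> KK h m mK; apply: h; exact: leq_trans KK. Qed.

Lemma cylinder_clopen m : clopen (cylinder m).
Proof.
rewrite /cylinder; case: unpickle => [[n j]|]; last first.
  by split; [exact: openT|exact: closedT].
have := @clopen_comp _ _ (fun x : X => x n) (A j) (A_clopen j).
by apply; exact: coordinate_continuous.
Qed.

Lemma cell_nbhs K x : nbhs x [set y | same_cell K x y].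
Proof.
elim: K => [|K IH].
  by apply: filterS filterT => y _ m; rewrite ltn0.
have : nbhs x [set y | cylinder K x <-> cylinder K y].
  have [oK cK] := cylinder_clopen K.
  case: (pselect (cylinder K x)) => h.
    by apply: filterS (open_nbhs_nbhs (conj oK h)) => y.
  have oC : open (~` cylinder K) by rewrite openC.
  by apply: filterS (open_nbhs_nbhs (conj oC h)) => y.
move=> H; apply: filterS (filterI IH H) => y [h1 h2] m.
rewrite ltnS leq_eqVlt => /predU1P[->//|]; exact: h1.
Qed.

(** The cells of [x] generate a filter that converges to [x] at each coordinate, hence
converges to [x]. *)
Lemma cell_in_nbhs (x : X) U : nbhs x U -> exists K, forall y, same_cell K x y -> U y.
Proof.
pose F : set_system X := [set U | exists K, forall y, same_cell K x y -> U y].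
have FF : Filter F.
  split; first by exists 0%N.
    move=> P Q [K HK] [K' HK']; exists (maxn K K') => y h; split.
      by apply: HK; apply: same_cellW h; rewrite leq_maxl.
    by apply: HK'; apply: same_cellW h; rewrite leq_maxr.
  by move=> P Q PQ [K HK]; exists K => y /HK /PQ.
suff : F --> x by apply.
apply: (@ptws_cvg int M) => n V; rewrite nbhs_simpl => /A_base [j [jx jV]].
exists (pickle (n, j)).+1 => y h; apply: jV.
by have := h _ (ltnSn _); rewrite /cylinder pickleK /= => -[+ _]; exact.
Qed.

Lemma same_cell_of_coordinates K : exists N : nat, forall x y : X,
  (forall n : int, (`|n| <= N)%N -> x n = y n) -> same_cell K x y.
Proof.
elim: K => [|K [N HN]]; first by exists 0%N => x y _ m; rewrite ltn0.
pose n := if @unpickle (int * nat)%type K is Some (n, _) then n else 0.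
exists (maxn N `|n|) => x y h m; rewrite ltnS leq_eqVlt => /predU1P[->|mK].
  rewrite /cylinder; move: @n h; case: unpickle => [[n j]|]//= h.
  by rewrite h// leq_maxr.
by apply: HN => // i iN; apply: h; rewrite leq_max iN.
Qed.

(** Compactness turns a level that depends on the point into a uniform one: every point has
a whole neighbourhood, namely one of its cells, on which a single level serves. *)
Lemma uniform_same_cell (P : X -> X -> Prop) :
  (forall x, exists K, forall y z, same_cell K x y -> same_cell K x z -> P y z) ->
  exists K, forall y z, same_cell K y z -> P y z.
Proof.
move=> H; have /compact_near_coveringP := shift_space_compact.
move=> /(_ nat \oo (fun K y => forall z, same_cell K y z -> P y z) _) [].
  move=> x _; have [K HK] := H x.
  exists ([set y | same_cell K x y], [set K' | (K <= K')%N]).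
    by split; [exact: cell_nbhs|exists K].
  move=> [y K'] /= [xy KK'] z yz; apply: HK => //.
  by apply: same_cell_trans xy _; exact: same_cellW yz.
by move=> K _ /(_ K (leqnn K)) h; exists K => y z; exact: h.
Qed.

Lemma uniform_oscillation (f : X -> R) (e : R) : continuous f -> 0 < e ->
  exists K, forall x y, same_cell K x y -> `|f x - f y| <= e.
Proof.
move=> fc e0; apply: uniform_same_cell => x.
have e20 : 0 < e / 2 by rewrite divr_gt0.
have /cell_in_nbhs[K HK] : nbhs x (f @^-1` ball (f x) (e / 2)).
  by apply: fc; exact: nbhsx_ballx.
exists K => y z /HK h1 /HK h2.
have -> : f y - f z = (f x - f z) - (f x - f y) by ring.
rewrite (le_trans (ler_normB _ _))// [leRHS]splitr lerD//; exact: ltW.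
Qed.

End cylinders.

(** * The metric of the shift space *)
Lemma nneseries_lty {R : realType} (u : R^nat) :
  cvgn (series u) -> (\sum_(k <oo) (u k)%:E < +oo)%E.
Proof.
move=> u_cvg; rewrite (_ : (fun n => _) = EFin \o series u); last first.
  by apply/funext => n /=; rewrite /series /= sumEFin.
rewrite (_ : limn _ = (limn (series u))%:E) ?ltry//.
by apply/cvg_lim => //; apply: cvg_EFin => //; exact: nearW.
Qed.

(** Each absolute value is taken at most twice: once by a natural number and once by a negative
integer. *)
Lemma esum_int_lty {R : realType} (w : R^nat) : (forall n, 0 <= w n) ->
  cvgn (series w) -> (\esum_(n in [set: int]) (w `|n|%N)%:E < +oo)%E.
Proof.
move=> w0 w_cvg; rewrite (esumID (range Posz)); last by move=> *; rewrite lee_fin.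
rewrite !setTI (_ : ~` range Posz = range Negz); last first.
  apply/seteqP; split => [[n|n] /= h|_ [n _ <-] [m _]//]; last by exists n.
  by exfalso; apply: h; exists n.
rewrite !esum_image; [|by move=> m n _ _ []|by move=> m n _ _ []].
rewrite -!nneseries_esumT; [|by move=> n; rewrite lee_fin..].
apply: lte_add_pinfty => /=; first exact: nneseries_lty.
apply: (@nneseries_lty _ (fun n => w n.+1)).
rewrite (_ : series _ = fun n => series w n.+1 - w 0%N); last first.
  by apply/funext => n; rewrite /series /= [in RHS]big_nat_recl//= addrC addKr.
apply/cvg_ex; exists (limn (series w) - w 0%N).
by apply: cvgB; [rewrite (cvg_shiftS (series w))|exact: cvg_cst].
Qed.

Section shift_metric.
Context {R : realType} {M : pmetricType R} {a : R^nat}.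
Notation X := (shift_space M).
Notation d := (@shift_dist R M a).
Hypothesis a_ge0 : forall n, 0 <= a n.

Let w0 n : 0 <= (a n + 1)^-1.
Proof. by rewrite invr_ge0 addr_ge0. Qed.

Let term0 (x y : X) (n : int) :
  (0 <= (Num.min (a `|n|%N + 1)^-1 (mdist (x n) (y n)))%:E)%E.
Proof. by rewrite lee_fin le_min w0 mdist_ge0. Qed.

Lemma shift_dist_sym x y : d x y = d y x.
Proof. by apply: eq_esum => n _; rewrite metric_sym. Qed.

Lemma shift_distxx x : d x x = 0%E.
Proof. by apply: esum1 => n _; rewrite mdistxx min_r. Qed.

Lemma shift_dist_triangle x y z : (d x z <= d x y + d y z)%E.
Proof.
rewrite /shift_dist -esumD//; apply: le_esum => n _; rewrite -EFinD lee_fin.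
have := metric_triangle (x n) (y n) (z n); have := w0 `|n|.
have := mdist_ge0 (x n) (y n); have := mdist_ge0 (y n) (z n).
by rewrite /Num.min; do ! case: ifPn; rewrite -?leNgt; lra.
Qed.

(** A single term of the sum is less than [e]; as its cap is at least [e], the minimum is the
distance between the coordinates. *)
Lemma shift_ball_coordinate (x y : X) e (n : int) : shift_ball a x e y ->
  e <= (a `|n|%N + 1)^-1 -> mdist (x n) (y n) < e.
Proof.
rewrite /shift_ball/= => dxy en.
have : ((Num.min (a `|n|%N + 1)^-1 (mdist (x n) (y n)))%:E < e%:E)%E.
  apply: le_lt_trans dxy; rewrite /shift_dist (esumID [set n])//.
  by rewrite setTI esum_set1// leeDl// esum_ge0.
by rewrite lte_fin gt_min ltNge en.
Qed.

Hypothesis M_compact : compact [set: M].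
Hypothesis a_summable : cvgn (series (fun k => (a k + 1)^-1)).
Variable A : nat -> set M.
Hypothesis A_clopen : forall j, clopen (A j).
Hypothesis A_base : forall x U, nbhs x U -> exists j, A j x /\ A j `<=` U.

Let coordinates_close (x : X) (s : seq int) (e : R) : 0 < e ->
  exists K, forall y, same_cell A K x y -> \sum_(n <- s) mdist (x n) (y n) < e.
Proof.
elim: s e => [|n s IH] e e0; first by exists 0%N => y _; rewrite big_nil.
have e20 : 0 < e / 2 by rewrite divr_gt0.
have [K HK] := IH _ e20.
have [K' HK'] : exists K, forall y, same_cell A K x y -> mdist (x n) (y n) < e / 2.
  apply: (cell_in_nbhs A A_base x [set y : X | mdist (x n) (y n) < e / 2]).
  have := @coordinate_continuous M n x (ball (x n) (e / 2)) (nbhsx_ballx _ _ e20).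
  by rewrite ballEmdist.
exists (maxn K K') => y h; rewrite big_cons [ltRHS]splitr ltrD//.
  by apply: HK'; apply: same_cellW h; rewrite leq_maxr.
by apply: HK; apply: same_cellW h; rewrite leq_maxl.
Qed.

(** The weights are summable, so a finite set [F] of coordinates carries all of them but
[e / 2]. Outside [F] the distance is at most the sum of the weights, and inside [F] a deep
enough cell makes the finitely many coordinates close. *)
Lemma shift_dist_cell (x : X) (e : R) : 0 < e ->
  exists K, forall y, same_cell A K x y -> (d x y < e%:E)%E.
Proof.
move=> e0; have e20 : 0 < e / 2 by rewrite divr_gt0.
pose W := \esum_(n in [set: int]) ((a `|n|%N + 1)^-1)%:E.
have Woo : (W < +oo)%E by exact: (@esum_int_lty _ (fun k => (a k + 1)^-1)).
have W0 (n : int) : (0 <= ((a `|n|%N + 1)^-1)%:E)%E by rewrite lee_fin.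
have Wfin : W \is a fin_num by rewrite ge0_fin_numE// esum_ge0.
have [_ [F [Ffin _] <-] HF] := @ub_ereal_sup_adherent _ _ _ e20 Wfin.
have tail : (\esum_(n in ~` F) ((a `|n|%N + 1)^-1)%:E <= (e / 2)%:E)%E.
  have := erefl W; rewrite {2}/W (esumID F)// !setTI.
  rewrite (@esum_fset _ _ F)// => WE.
  move: HF; rewrite [X in (X < _)%E -> _](_ : _ = W - (e / 2)%:E)%E// lteBlDr//.
  rewrite WE; set S := (\sum_(i \in F) _)%E.
  have Sfin : S \is a fin_num.
    have S0 : (0 <= S)%E by rewrite /S; apply: fsume_ge0.
    rewrite ge0_fin_numE//; apply: le_lt_trans Woo; rewrite WE leeDl//.
    exact: esum_ge0.
  by rewrite lteD2lE// => /ltW.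
have [K HK] := coordinates_close x (finmap.enum_fset (fset_set F)) _ e20.
exists K => y /HK h; rewrite /shift_dist (esumID F)// !setTI.
rewrite [ltRHS](_ : _ = (e / 2)%:E + (e / 2)%:E)%E; last by rewrite -EFinD -splitr.
apply: lte_leD => //.
- rewrite ge0_fin_numE ?esum_ge0// (le_lt_trans _ (ltry (e / 2)))//.
  by rewrite (le_trans _ tail)// le_esum// => n _; rewrite lee_fin ge_min lexx.
- rewrite esum_fset// fsbig_finite//=.
  move: h; rewrite -lte_fin -sumEFin; apply: le_lt_trans; apply: lee_sum => n _.
  by rewrite lee_fin ge_min lexx orbT.
- by apply: le_trans tail; apply: le_esum => n _; rewrite lee_fin ge_min lexx.
Qed.

Lemma shift_ball_open (x : X) (e : R) : open (shift_ball a x e).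
Proof.
rewrite openE => y; rewrite /shift_ball/= => dxy.
have dfin : d x y \is a fin_num.
  by rewrite ge0_fin_numE ?(lt_trans dxy) ?ltry// esum_ge0.
have r0 : 0 < e - fine (d x y).
  by rewrite subr_gt0 -lte_fin fineK.
have [K HK] := shift_dist_cell y _ r0.
apply: filterS (cell_nbhs A A_clopen K y) => z /HK /= dyz.
apply: le_lt_trans (shift_dist_triangle x y z) _.
have -> : (e%:E = d x y + (e - fine (d x y))%:E)%E.
  by rewrite -{1}(fineK dfin) -EFinD addrC subrK.
by rewrite lteD2lE.
Qed.

Lemma shift_dist_uniform (e : R) : 0 < e ->
  exists K, forall x y, same_cell A K x y -> (d x y < e%:E)%E.
Proof.
move=> e0; apply: uniform_same_cell => // x.
have e20 : 0 < e / 2 by rewrite divr_gt0.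
have [K HK] := shift_dist_cell x _ e20; exists K => y z /HK xy /HK xz.
apply: le_lt_trans (shift_dist_triangle y x z) _.
by rewrite (splitr e) EFinD lteD// shift_dist_sym.
Qed.

End shift_metric.

(** * Integration over cells *)
Lemma open_borel {T : ptopologicalType} (U : set (shift_space T)) :
  open U -> measurable U.
Proof. exact: sub_sigma_algebra. Qed.

(** The integral of a nonnegative function is the supremum of the integrals of the simple
functions below it, hence monotone, whether or not the functions are measurable. This is how
the function that maps [x] to the measure of [B(x, e)] is compared with step functions. *)
Lemma ge0_le_integral_any {d} {T : measurableType d} {R : realType}
    (mu : {measure set T -> \bar R}) (D : set T) (f g : T -> \bar R) :
  (forall x, D x -> (0 <= f x)%E) -> (forall x, D x -> (f x <= g x)%E) ->
  (\int[mu]_(x in D) f x <= \int[mu]_(x in D) g x)%E.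
Proof.
move=> f0 fg; have g0 x : D x -> (0 <= g x)%E.
  by move=> Dx; exact: le_trans (f0 _ Dx) (fg _ Dx).
rewrite !ge0_integralE//; apply: ereal_sup_le => _ [h hf <-]; exists h => //.
by move=> x; apply: le_trans (hf x) _; apply: lee_restrict.
Qed.

Section labels.
Context {R : realType} {M : pmetricType R}.
Notation X := (shift_space M).
Variable A : nat -> set M.
Hypothesis A_clopen : forall j, clopen (A j).

(** A cell of level [K] is named by the set of the first [K] cylinders that contain it; some
labels name the empty set. *)
Definition label K (x : X) : {ffun 'I_K -> bool} := [ffun i : 'I_K => `[< cylinder A i x >]].

Definition cell K (l : {ffun 'I_K -> bool}) : set X := label K @^-1` [set l].

Lemma labelP K x y : label K x = label K y <-> same_cell A K x y.
Proof.
split => [h m mK|h].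
  have /ffunP/(_ (Ordinal mK)) := h; rewrite !ffunE /= => e.
  by split => /asboolP hx; apply/asboolP; rewrite ?e// -e.
by apply/ffunP => i; rewrite !ffunE; apply: asbool_equiv_eq; exact: h.
Qed.

(** The finite unions of cells of level [K]. *)
Definition saturated K (B : set X) := forall x y, same_cell A K x y -> B x -> B y.

Lemma saturated_open K B : saturated K B -> open B.
Proof.
by move=> Bs; rewrite openE => x Bx; apply: filterS (cell_nbhs A A_clopen K x) => y /Bs; exact.
Qed.

Lemma saturated_clopen K B : saturated K B -> clopen B.
Proof.
move=> Bs; split; first exact: saturated_open Bs.
rewrite -openC; apply: (@saturated_open K) => x y xy nx By; apply: nx.
by apply: Bs By; exact: same_cell_sym.
Qed.

Lemma saturated_measurable K B : saturated K B -> measurable B.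
Proof. by move=> /saturated_open/open_borel. Qed.

Lemma label_saturated K (S : set {ffun 'I_K -> bool}) : saturated K (label K @^-1` S).
Proof. by move=> x y /labelP; rewrite /preimage/= => ->. Qed.

Lemma cell_measurable K l : measurable (cell K l).
Proof. by apply: (@saturated_measurable K); exact: label_saturated. Qed.

Lemma measurable_label K (g : {ffun 'I_K -> bool} -> R) :
  measurable_fun [set: X] (g \o label K).
Proof.
move=> _ Y _; rewrite setTI; apply: (@saturated_measurable K).
exact: (@label_saturated K (g @^-1` Y)).
Qed.

Lemma bigcup_cells K : \big[setU/set0]_(l <- enum {ffun 'I_K -> bool}) cell K l = [set: X].
Proof.
apply/seteqP; split => // x _; rewrite -bigcup_seq.
by exists (label K x); rewrite /= ?mem_enum.
Qed.

Lemma trivIset_cells K (D : set {ffun 'I_K -> bool}) : trivIset D (cell K).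
Proof. by move=> i j _ _ [x [<- <-]]. Qed.

Lemma integral_label (mu : {measure set X -> \bar R}) K (g : {ffun 'I_K -> bool} -> R) :
  (\int[mu]_x (g (label K x))%:E = \sum_l (g l)%:E * mu (cell K l))%E.
Proof.
have := @integral_bigsetU_EFin _ _ _ mu _ (cell K) (g \o label K) (enum {ffun 'I_K -> bool})
  (cell_measurable K) (enum_uniq _) (trivIset_cells K _).
rewrite /= bigcup_cells => ->; last by apply/measurable_EFinP; exact: measurable_label.
rewrite big_enum /=; apply: eq_bigr => l _.
rewrite -integral_cst; last exact: cell_measurable.
by apply: eq_integral => x; rewrite inE /cell /= => ->.
Qed.

Lemma sum_measure_cells (mu : probability X R) K : (\sum_l mu (cell K l) = 1)%E.
Proof.
transitivity (mu [set: X]); last exact: probability_setT.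
have := integral_label mu K (fun=> 1); rewrite integral_cst// mul1e => ->.
by apply: eq_bigr => l _; rewrite mul1e.
Qed.

End labels.

Arguments label {R M}.
Arguments cell {R M}.
Arguments saturated {R M}.

(** * The topological support *)
Section support.
Context {R : realType} {M : pmetricType R}.
Notation X := (shift_space M).
Variable A : nat -> set M.
Hypothesis A_clopen : forall j, clopen (A j).
Hypothesis A_base : forall x U, nbhs x U -> exists j, A j x /\ A j `<=` U.
Variable mu : invariant_probability M.

(** A point outside the support has a null neighbourhood, hence lies in a null cell. So the
complement of the support is a countable union of clopen sets; this is what makes it
measurable and negligible. *)
Lemma msuppC : ~` msupp mu = \bigcup_K [set x | mu (cell A K (label A K x)) = 0%E].
Proof.
apply/seteqP; split => x /=.
  move=> /existsNP[U /not_implyP[oU /not_implyP[Ux /negP]]].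
  rewrite -leNgt => mU.
  have [K HK] := cell_in_nbhs A A_base x U (open_nbhs_nbhs (conj oU Ux)).
  exists K => //=; apply/eqP; rewrite eq_le measure_ge0 andbT.
  apply: le_trans mU; apply: le_measure; rewrite ?inE.
  - exact: cell_measurable.
  - exact: open_borel.
  - by move=> y; rewrite /cell/= => /esym/labelP /HK.
move=> [K _ /= m0] h.
have := h (cell A K (label A K x)) (saturated_open A A_clopen K _ (label_saturated A K _)) erefl.
by rewrite m0 ltxx.
Qed.

Lemma null_cells_saturated K :
  saturated A K [set x | mu (cell A K (label A K x)) = 0%E].
Proof. by move=> x y /labelP /= ->. Qed.

Lemma msuppC_measurable : measurable (~` msupp mu).
Proof.
rewrite msuppC; apply: bigcupT_measurable => K.
exact: saturated_measurable (null_cells_saturated K).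
Qed.

Lemma measure_msuppC : mu (~` msupp mu) = 0%E.
Proof.
apply/eqP; rewrite eq_le measure_ge0 andbT.
have mK K : measurable [set x : X | mu (cell A K (label A K x)) = 0%E].
  exact: saturated_measurable (null_cells_saturated K).
rewrite msuppC; apply: le_trans (generalized_Boole_inequality mu mK _) _.
  exact: bigcupT_measurable.
rewrite eseries0// => K _ _.
have := integral_label A A_clopen mu K (fun l => (mu (cell A K l) == 0%E)%:R).
rewrite big1 => [|l _]; last by case: eqP => [e|_]; [rewrite mul1e; exact: e|rewrite mul0e].
have -> : (fun x : X => ((mu (cell A K (label A K x)) == 0%E)%:R)%:E : \bar R) =
  (fun x => (\1_[set x : X | mu (cell A K (label A K x)) = 0%E] x)%:E).
  apply/funext => x; rewrite indicE; case: eqP => h.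
    by have -> : x \in [set x | mu (cell A K (label A K x)) = 0%E] by exact: mem_set.
  have /negPf->// : x \notin [set x | mu (cell A K (label A K x)) = 0%E].
  by apply/negP; rewrite inE.
by rewrite integral_indic// setIT.
Qed.

Lemma integral_msupp (f : X -> \bar R) : measurable_fun [set: X] f ->
  (forall x, (0 <= f x)%E) -> (\int[mu]_(x in msupp mu) f x = \int[mu]_x f x)%E.
Proof.
move=> mf f0; rewrite [RHS](@ge0_negligible_integral _ _ _ _ _ (~` msupp mu))//.
- by rewrite setTD setCK.
- exact: msuppC_measurable.
- exact: measure_msuppC.
Qed.

Lemma msupp_measurable : measurable (msupp mu).
Proof. by rewrite -[msupp mu]setCK; apply: measurableC; exact: msuppC_measurable. Qed.

End support.

(** * Dimensions at a fixed scale *)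
(** Arbitrarily large values at arbitrarily small scales. A single [n] bounds both the scale and
the value, because the condition for a large [n] implies it for the smaller ones. *)
Lemma limf_esup_right_pinfty {R : realType} (f : R -> \bar R) :
  limf_esup f 0^'+ = +oo%E <->
  forall n : nat, exists e : R, 0 < e < n.+1%:R^-1 /\ (n%:R%:E < f e)%E.
Proof.
rewrite limf_esupE ereal_inf_pinfty; split => [H n|H _ [V V0 <-] /=].
  pose V := [set e : R | 0 < e < n.+1%:R^-1].
  have : (n%:R%:E < ereal_sup (f @` V))%E.
    rewrite (H (ereal_sup _)) ?ltry//; exists V => //.
    exists n.+1%:R^-1 => /=; first by rewrite invr_gt0.
    move=> e; rewrite /= sub0r normrN => h e0.
    by rewrite /V /= e0 (le_lt_trans (ler_norm e)).
  by move=> /ereal_sup_gt[_ [e he <-] nf]; exists e.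
have [d /= d0 dV] := V0; have [m md] := exists_invn_lt d d0.
apply/eqyP => r r0; have [k kr] : exists k : nat, r <= k%:R.
  by exists (Num.trunc r).+1; rewrite ltW// truncnS_gt.
have [e [/andP[e0 em] fe]] := H (maxn k m).
apply: (@le_trans _ _ (f e)).
  by apply: le_trans (ltW fe); rewrite lee_fin (le_trans kr)// ler_nat leq_maxl.
apply: ereal_sup_ubound; exists e => //; apply: dV => //=.
rewrite sub0r normrN gtr0_norm//; apply: lt_trans md; apply: lt_le_trans em _.
by rewrite lef_pV2 ?posrE// ler_nat ltnS leq_maxr.
Qed.

Section dimension_criteria.
Context {R : realType} {M : pmetricType R} {a : R^nat}.
Implicit Types (mu : invariant_probability M) (q e : R).

Lemma ball_moment_ge0 mu q e : (0 <= ball_moment a mu q e)%E.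
Proof. by apply: integral_ge0 => x _; exact: poweR_ge0. Qed.

(** Multiplying by [(q - 1) * ln e], which is negative, reverses the inequality; then take
exponentials. *)
Lemma upper_fractal_dim_pinftyP mu q : 1 < q ->
  upper_fractal_dim a mu q = +oo%E <->
  forall n : nat, exists e : R, 0 < e < n.+1%:R^-1 /\
    (ball_moment a mu q e < (e `^ (n%:R * (q - 1)))%:E)%E.
Proof.
move=> q1; rewrite /upper_fractal_dim limf_esup_right_pinfty.
have key n e : 0 < e < n.+1%:R^-1 ->
    (n%:R%:E < lne (ball_moment a mu q e) / ((q - 1) * ln e)%:E)%E =
    (ball_moment a mu q e < (e `^ (n%:R * (q - 1)))%:E)%E.
  move=> /andP[e0 en]; have e1 : e < 1.
    by apply: lt_le_trans en _; rewrite invf_le1 ?ler1n.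
  have c0 : (q - 1) * ln e < 0.
    by rewrite pmulr_rlt0 ?subr_gt0// ln_lt0// e0.
  rewrite inver lt_eqF// lte_ndivlMr// -[LHS]lte_expeR lneK; last first.
    by rewrite in_itv /= ball_moment_ge0 leey.
  by rewrite -EFinM /= /powR gt_eqF// mulrA.
by split=> H n; have [e [he h]] := H n; exists e; split => //; rewrite ?key// -key.
Qed.

Lemma upper_entropy_dim_pinfty mu :
  (forall n : nat, exists e : R, 0 < e < n.+1%:R^-1 /\
    (\int[mu]_(x in msupp mu) lne (mu (shift_ball a x e)) < (n%:R * ln e)%:E)%E) ->
  upper_entropy_dim a mu = +oo%E.
Proof.
move=> H; apply/limf_esup_right_pinfty => n; have [e [he h]] := H n.
exists e; split => //; have /andP[e0 en] := he.
have e1 : e < 1 by apply: lt_le_trans en _; rewrite invf_le1 ?ler1n.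
have c0 : ln e < 0 by rewrite ln_lt0// e0.
by rewrite inver lt_eqF// lte_ndivlMr// -EFinM.
Qed.

End dimension_criteria.

Section finite_approximation.
Context {R : realType} {M : pmetricType R} {a : R^nat}.
Notation X := (shift_space M).
Hypothesis M_compact : compact [set: M].
Hypothesis a_ge0 : forall n, 0 <= a n.
Hypothesis a_summable : cvgn (series (fun k => (a k + 1)^-1)).
Variable A : nat -> set M.
Hypothesis A_clopen : forall j, clopen (A j).
Hypothesis A_base : forall x U, nbhs x U -> exists j, A j x /\ A j `<=` U.
Implicit Types (mu : invariant_probability M) (q e : R).

(** For cells of diameter less than [e / 2], the union [V l] of all cells that meet the
[e]-ball of some point of [l] stays within [e / 2 + e + e / 2] of every point of [l]. *)
Lemma finite_ball_approximation e : 0 < e ->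
  exists K (V : {ffun 'I_K -> bool} -> set X),
    (forall l, saturated A K (V l)) /\
    (forall x, shift_ball a x e `<=` V (label A K x)) /\
    (forall x, V (label A K x) `<=` shift_ball a x (e * 2)).
Proof.
move=> e0; have e20 : 0 < e / 2 by rewrite divr_gt0.
have [K HK] := shift_dist_uniform a_ge0 M_compact a_summable A A_clopen A_base _ e20.
exists K, (fun l => [set y | exists x z,
  [/\ label A K x = l, shift_ball a x e z & same_cell A K z y]]).
split; [|split].
- move=> l y y' yy' [x [z [xl xz zy]]]; exists x, z; split => //.
  exact: same_cell_trans zy yy'.
- by move=> x y xy; exists x, y.
- move=> x y [x' [z [/labelP xx' x'z zy]]]; rewrite /shift_ball /=.
  apply: le_lt_trans (shift_dist_triangle a_ge0 x x' y) _.
  have -> : ((e * 2)%:E = (e / 2)%:E + (e + e / 2)%:E)%E by rewrite -EFinD; congr (_%:E); lra.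
  apply: lteD; first by apply: HK; exact: same_cell_sym.
  apply: le_lt_trans (shift_dist_triangle a_ge0 x' z y) _.
  by rewrite EFinD; apply: lteD => //; exact: HK.
Qed.

(** The moment of order [q] when the sets [V l] stand for the balls; only finitely many clopen
sets enter, whence its weak continuity. *)
Definition cell_moment mu q K (V : {ffun 'I_K -> bool} -> set X) : R :=
  \sum_l fine (mu (cell A K l)) * fine (mu (V l)) `^ (q - 1).

Section fixed_scale.
Variables (K : nat) (V : {ffun 'I_K -> bool} -> set X).
Hypothesis V_sat : forall l, saturated A K (V l).
Variable mu : invariant_probability M.

Let V_meas l : measurable (V l).
Proof. exact: saturated_measurable (V_sat l). Qed.

Let fin_mu (B : set X) : measurable B -> mu B = (fine (mu B))%:E.
Proof. by move=> mB; rewrite fineK// fin_num_measure. Qed.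

(** The form in which the sum can be compared with the moment of the balls, under one integral
sign. *)
Lemma cell_momentE q : (cell_moment mu q K V)%:E =
  (\int[mu]_x (fine (mu (V (label A K x))) `^ (q - 1))%:E)%E.
Proof.
rewrite (integral_label A A_clopen mu K (fun l => fine (mu (V l)) `^ (q - 1))).
rewrite /cell_moment -sumEFin; apply: eq_bigr => l _.
by rewrite EFinM muleC -fin_mu//; exact: cell_measurable.
Qed.

Let ball_measurable (x : X) e : measurable (shift_ball a x e).
Proof.
apply: open_borel; exact: (shift_ball_open a_ge0 a_summable A A_clopen A_base).
Qed.

Lemma ball_moment_le_cells q e : 1 < q ->
  (forall x, shift_ball a x e `<=` V (label A K x)) ->
  (ball_moment a mu q e <= (cell_moment mu q K V)%:E)%E.
Proof.
move=> q1 HV; have q0 : 0 <= q - 1 by rewrite subr_ge0 ltW.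
rewrite cell_momentE -(integral_msupp A A_clopen A_base); last 2 first.
- apply/measurable_EFinP.
  exact: (measurable_label A A_clopen K (fun l => fine (mu (V l)) `^ (q - 1))).
- by move=> x; rewrite lee_fin powR_ge0.
apply: ge0_le_integral_any => x _; first exact: poweR_ge0.
rewrite fin_mu// poweR_EFin lee_fin ge0_ler_powR ?nnegrE ?fine_ge0//.
apply: fine_le; rewrite ?fin_num_measure//.
by apply: le_measure; rewrite ?inE.
Qed.

Lemma cells_le_ball_moment q e : 1 < q ->
  (forall x, V (label A K x) `<=` shift_ball a x e) ->
  ((cell_moment mu q K V)%:E <= ball_moment a mu q e)%E.
Proof.
move=> q1 HV; have q0 : 0 <= q - 1 by rewrite subr_ge0 ltW.
rewrite cell_momentE -(integral_msupp A A_clopen A_base); last 2 first.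
- apply/measurable_EFinP.
  exact: (measurable_label A A_clopen K (fun l => fine (mu (V l)) `^ (q - 1))).
- by move=> x; rewrite lee_fin powR_ge0.
apply: ge0_le_integral_any => x _; first by rewrite lee_fin powR_ge0.
rewrite (fin_mu (shift_ball a x e))// poweR_EFin lee_fin.
rewrite ge0_ler_powR ?nnegrE ?fine_ge0//.
apply: fine_le; rewrite ?fin_num_measure//.
by apply: le_measure; rewrite ?inE.
Qed.

(** Jensen inequality for the logarithm, from the tangent line at [J], which gives
[ln v <= ln J + (v / J - 1)] for every [v > 0]. Averaged over the cells, the second term
vanishes. *)
Lemma entropy_le_ln_cells e : 0 < e ->
  (forall x, shift_ball a x e `<=` V (label A K x)) ->
  0 < cell_moment mu 2 K V /\
  (\int[mu]_(x in msupp mu) lne (mu (shift_ball a x e)) <=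
   (ln (cell_moment mu 2 K V))%:E)%E.
Proof.
move=> e0 HV; set J := cell_moment mu 2 K V.
pose p l := fine (mu (cell A K l)); pose v l := fine (mu (V l)).
have p0 l : 0 <= p l by exact: fine_ge0.
have v0 l : 0 <= v l by exact: fine_ge0.
have v1 l : v l <= 1.
  by rewrite -lee_fin -fin_mu// probability_le1.
have JE : J = \sum_l p l * v l.
  by apply: eq_bigr => l _; rewrite (_ : 2 - 1 = 1 :> R) ?powRr1 ?v0//; ring.
have sp : \sum_l p l = 1.
  apply: EFin_inj; rewrite -sumEFin -(sum_measure_cells A A_clopen mu K).
  by apply: eq_bigr => l _; rewrite -fin_mu//; exact: cell_measurable.
(* The cell lies in [V l], by considering the balls around its own points. So a cell of
   positive mass has [v l > 0], and the tangent inequality applies to it. *)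
have pv l : p l <= v l.
  have [l0|/set0P[x xl]] := eqVneq (cell A K l) set0.
    by rewrite /p l0 measure0 v0.
  apply: fine_le; rewrite ?fin_num_measure//; first exact: cell_measurable.
  apply: le_measure; rewrite ?inE//; first exact: cell_measurable.
  move=> y yl; rewrite -[l]yl; apply: HV.
  by rewrite /shift_ball /= shift_distxx// lte_fin.
have J0 : 0 < J.
  rewrite JE lt_neqAle sumr_ge0 ?andbT; last by move=> l _; exact: mulr_ge0.
  apply/eqP => /esym/eqP; rewrite psumr_eq0; last by move=> l _; exact: mulr_ge0.
  move=> /allP pvz; move: (oner_neq0 R); rewrite -sp big1 ?eqxx// => l _.
  have := pvz l; rewrite mem_index_enum => /(_ isT) /=.
  rewrite mulf_eq0 => /orP[/eqP//|/eqP vz].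
  by apply/eqP; rewrite eq_le p0 -vz pv.
split=> //; have lnv l : 0 < v l -> ln (v l) <= ln J + (v l / J - 1).
  move=> vl; have uJ : 0 < v l / J by exact: divr_gt0.
  rewrite -{1}(divfK (lt0r_neq0 J0) (v l)) lnM ?posrE//.
  have := @le_ln1Dx _ (v l / J - 1); rewrite [1 + _]addrC subrK => h.
  by rewrite addrC lerD2l h// ltrBrDl subrr.
(* The comparison is made for the opposite functions, which are nonnegative, so that no
   measurability of the ball measures is needed. *)
have step : (\int[mu]_(x in msupp mu) - lne (mu (shift_ball a x e)) >=
             \int[mu]_x (- ln (v (label A K x)))%:E)%E.
  rewrite -(integral_msupp A A_clopen A_base mu); last 2 first.
  - apply/measurable_EFinP.
    exact: (measurable_label A A_clopen K (fun l => - ln (v l))).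
  - by move=> x; rewrite lee_fin oppr_ge0 ln_le0.
  apply: ge0_le_integral_any => x _; first by rewrite lee_fin oppr_ge0 ln_le0.
  rewrite EFinN leeN2 fin_mu//; have [b0|b0] := leP (fine (mu (shift_ball a x e))) 0.
    by rewrite le0_lneNy// leNye.
  have bv : fine (mu (shift_ball a x e)) <= v (label A K x).
    apply: fine_le; rewrite ?fin_num_measure//.
    by apply: le_measure; rewrite ?inE.
  by rewrite lne_EFin// lee_fin ler_ln ?posrE// (lt_le_trans b0).
rewrite (_ : (fun x => lne _) = fun x => (- - lne (mu (shift_ball a x e)))%E); last first.
  by apply/funext => x; rewrite oppeK.
rewrite integral_ge0N; last first.
  by move=> x _; rewrite oppe_ge0 lne_le0 probability_le1.
rewrite leeNl; apply: le_trans step; rewrite -EFinN.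
rewrite (integral_label A A_clopen mu K (fun l => - ln (v l))).
rewrite (eq_bigr (fun l => (- (p l * ln (v l)))%:E)); last first.
  move=> l _; rewrite mulrC -mulNr EFinM; congr (_ * _)%E.
  exact: fin_mu (cell_measurable A A_clopen K l).
rewrite sumEFin lee_fin sumrN lerN2.
apply: (@le_trans _ _ (\sum_l (p l * (ln J - 1) + p l * v l / J))).
  apply: ler_sum => l _; have := p0 l; rewrite le_eqVlt => /predU1P[<-|pl].
    by rewrite !mul0r addr0.
  rewrite -mulrA -mulrDr ler_wpM2l// (le_trans (lnv l (lt_le_trans pl (pv l))))//.
  by rewrite addrA addrAC.
by rewrite big_split /= -!mulr_suml sp mul1r -JE divff ?gt_eqF// subrK.
Qed.

End fixed_scale.
End finite_approximation.

(** * Infinite dimension is a G-delta condition *)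
(** Where [f] vanishes, the power is not differentiable for a small exponent, and the estimate
[f y `^ r < e] is taken from [f y < e `^ r^-1]. *)
Lemma continuous_powR_nonneg {R : realType} {T : topologicalType} (f : T -> R) (r : R) :
  0 < r -> (forall x, 0 <= f x) -> continuous f -> continuous (fun x => f x `^ r).
Proof.
move=> r0 f0 fc x; have := f0 x; rewrite le_eqVlt => /predU1P[fx0|fx].
  rewrite /continuous_at -fx0 powR0 ?gt_eqF//; apply/cvgrPdist_lt => e e0.
  have e'0 : 0 < e `^ r^-1 by rewrite powR_gt0.
  have := fc x; rewrite /continuous_at -fx0 => /cvgrPdist_lt/(_ _ e'0).
  apply: filterS => y; rewrite !sub0r !normrN !ger0_norm ?powR_ge0// => h.
  rewrite -[ltRHS](powRr1 (ltW e0)) -(mulVf (lt0r_neq0 r0)) powRrM.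
  by apply: gt0_ltr_powR => //; rewrite nnegrE ?powR_ge0.
apply: (@continuous_comp _ _ _ f (fun u : R => u `^ r)); first exact: fc.
apply: differentiable_continuous; apply/derivable1_diffP.
by apply: derivable_powR; rewrite in_itv /= fx.
Qed.

Lemma continuous_indic_clopen {R : realType} {T : topologicalType} (C : set T) :
  clopen C -> continuous (\1_C : T -> R).
Proof.
move=> [oC cC] x; apply: cvg_near_cst; case: (pselect (C x)) => h.
  apply: filterS (open_nbhs_nbhs (conj oC h)) => y Cy.
  by rewrite !indicE !mem_set.
have oC' : open (~` C) by rewrite openC.
apply: filterS (open_nbhs_nbhs (conj oC' h)) => y Cy.
by rewrite !indicE !memNset.
Qed.

Section weak_topology.
Context {R : realType} {M : pmetricType R}.
Notation X := (shift_space M).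

Lemma continuous_integral (f : bounded_continuous M) :
  continuous (fun mu : invariant_probability M => \int[mu]_x sval f x).
Proof.
move=> mu.
apply: (@continuous_comp _ _ _ (@integral_eval R M)
  (fun F : {ptws bounded_continuous M -> R} => F f)).
  exact: initial_continuous.
exact: ptws_eval_continuous.
Qed.

Lemma continuous_measure_clopen (C : set X) : clopen C ->
  continuous (fun mu : invariant_probability M => fine (mu C)).
Proof.
move=> cC; have bC : bounded_fun (\1_C : X -> R).
  exists 1; split=> [|u u1 x _]; first exact: real1.
  by rewrite /= indicE (le_trans _ (ltW u1))//; case: (_ \in _); rewrite ?normr1 ?normr0.
pose f : bounded_continuous M := exist _ (\1_C : X -> R)
  (conj (continuous_indic_clopen C cC) bC).
have -> : (fun mu : invariant_probability M => fine (mu C)) =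
    fun mu : invariant_probability M => \int[mu]_x sval f x.
  apply/funext => mu; rewrite /Rintegral /= integral_indic ?setIT//.
  by apply: open_borel; exact: (proj1 cC).
exact: continuous_integral.
Qed.

End weak_topology.

Section infinite_dimension_Gdelta.
Context {R : realType} {M : pmetricType R} {a : R^nat}.
Notation X := (shift_space M).
Hypothesis M_compact : compact [set: M].
Hypothesis a_ge0 : forall n, 0 <= a n.
Hypothesis a_summable : cvgn (series (fun k => (a k + 1)^-1)).
Variable A : nat -> set M.
Hypothesis A_clopen : forall j, clopen (A j).
Hypothesis A_base : forall x U, nbhs x U -> exists j, A j x /\ A j `<=` U.

Lemma continuous_cell_moment q K (V : {ffun 'I_K -> bool} -> set X) : 1 < q ->
  (forall l, saturated A K (V l)) ->
  continuous (fun mu : invariant_probability M => cell_moment A mu q K V).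
Proof.
move=> q1 V_sat; apply: continuous_big => [|l _ mu]; first exact: add_continuous.
apply: cvgM; first exact: (@nbhs_filter (invariant_probability M) mu).
  apply: continuous_measure_clopen; apply: (@saturated_clopen _ _ A A_clopen K).
  exact: label_saturated.
apply: (@continuous_powR_nonneg R (invariant_probability M) (fun nu => fine (nu (V l))) (q - 1)).
- by rewrite subr_gt0.
- by move=> nu; exact: fine_ge0.
- apply: continuous_measure_clopen; exact: saturated_clopen (V_sat l).
Qed.

(** The inclusion of the balls in the [V l] makes the moment of the balls less than
[e ^ (n (q - 1))] as well. The existential form is a union of open conditions on [mu]. *)
Definition small_cell_moment q (n : nat) : set (invariant_probability M) :=
  [set mu | exists e K (V : {ffun 'I_K -> bool} -> set X),
    [/\ 0 < e < n.+1%:R^-1, forall l, saturated A K (V l),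
        forall x, shift_ball a x e `<=` V (label A K x) &
        cell_moment A mu q K V < e `^ (n%:R * (q - 1))] ].

Lemma small_cell_moment_open q n : 1 < q -> open (small_cell_moment q n).
Proof.
move=> q1; rewrite openE => mu [e [K [V [he V_sat HV h]]]].
have := continuous_cell_moment q K V q1 V_sat mu.
move=> /(cvgr_lt (cell_moment A mu q K V)) /(_ _ h).
by apply: filterS => nu hnu; exists e, K, V.
Qed.

(** Passing from balls to cells halves the scale. Doubling [n] beforehand absorbs the loss,
since [e ^ 2 <= e / 2] for [e <= 1 / 2]. *)
Lemma upper_fractal_dim_pinfty_Gdelta q : 1 < q ->
  [set mu : invariant_probability M | upper_fractal_dim a mu q = +oo%E] =
  \bigcap_n small_cell_moment q n.
Proof.
move=> q1; apply/seteqP; split => mu /=.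
  move=> /(upper_fractal_dim_pinftyP _ _ q1) H n _.
  have [e [/andP[e0 en] he]] := H n.*2.+1.
  have e2 : 2 * e < 1.
    rewrite mulrC -ltr_pdivlMr// mul1r; apply: lt_le_trans en _.
    by rewrite lef_pV2 ?posrE// ler_nat.
  have e20 : 0 < e / 2 by rewrite divr_gt0.
  have [K [V [V_sat [BV VB]]]] := finite_ball_approximation M_compact a_ge0 a_summable
    A A_clopen A_base _ e20.
  exists (e / 2), K, V; split => //.
    rewrite e20 (lt_trans (_ : e / 2 < e)) ?(lt_le_trans en) ?lef_pV2 ?posrE//; last first.
      by rewrite ler_nat; lia.
    by lra.
  rewrite -lte_fin; apply: (@le_lt_trans _ _ (ball_moment a mu q e)).
    apply: (cells_le_ball_moment a_ge0 a_summable A A_clopen A_base K V V_sat mu q e q1).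
    by move=> x; move: (VB x); rewrite divfK.
  apply: lt_le_trans he _; rewrite lee_fin.
  have q0 : 0 <= q - 1 by rewrite subr_ge0 ltW.
  apply: (@le_trans _ _ (e `^ (n.*2%:R * (q - 1)))).
    apply: ger_powR; first by lra.
    by rewrite ler_wpM2r// ler_nat.
  have -> : n.*2%:R * (q - 1) = 2%:R * (n%:R * (q - 1)) by rewrite -mul2n natrM mulrA.
  rewrite (powRrM e 2) ge0_ler_powR ?nnegrE ?powR_ge0 ?(ltW e20) ?mulr_ge0//.
  by rewrite powR_mulrn ?ltW// expr2; nra.
move=> H; apply/upper_fractal_dim_pinftyP => // n.
have [e [K [V [he V_sat HV h]]]] := H n I.
exists e; split => //; apply: le_lt_trans (_ : _ <= (cell_moment A mu q K V)%:E)%E _.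
  exact: ball_moment_le_cells HV.
by rewrite lte_fin.
Qed.

(** At the scales that witness the infinite dimension of order 2, the logarithm of the cell
moment is less than [n * ln e], and it bounds the integral of the logarithm. *)
Lemma upper_entropy_dim_pinfty_of_fractal (mu : invariant_probability M) :
  upper_fractal_dim a mu 2 = +oo%E -> upper_entropy_dim a mu = +oo%E.
Proof.
have q1 : 1 < 2 :> R by lra.
move=> mu_oo; have : (\bigcap_n small_cell_moment 2 n) mu.
  by rewrite -upper_fractal_dim_pinfty_Gdelta.
move=> H; apply: upper_entropy_dim_pinfty => n.
have [e [K [V [he V_sat HV h]]]] := H n I.
exists e; split => //; have /andP[e0 _] := he.
have [J0 hJ] :=
  entropy_le_ln_cells a_ge0 a_summable A A_clopen A_base K V V_sat mu e e0 HV.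
apply: le_lt_trans hJ _; rewrite lte_fin -ltr_expR lnK ?posrE//.
by move: h; rewrite /powR gt_eqF// (_ : 2 - 1 = 1 :> R) ?mulr1//; ring.
Qed.

End infinite_dimension_Gdelta.

(** * Fair coins from binary digits *)
Section finite_valued.
Context {d} {T : measurableType d} {R : realType} {F : finType} (w : T -> F).
Hypothesis w_meas : forall f, measurable (w @^-1` [set f]).

Let bigsetU_fibers (P : pred F) :
  \big[setU/set0]_(f <- enum P) w @^-1` [set f] = [set t | P (w t)].
Proof.
rewrite -bigcup_seq; apply/seteqP; split => [t [f /=]|t /= Pt].
  by rewrite mem_enum => Pf wf; rewrite wf.
by exists (w t); rewrite //= mem_enum.
Qed.

Lemma finite_valued_measurable (P : pred F) : measurable [set t | P (w t)].
Proof. by rewrite -bigsetU_fibers; apply: bigsetU_measurable. Qed.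

Lemma finite_valued_measure (mu : {measure set T -> \bar R}) (P : pred F) :
  (mu [set t | P (w t)] = \sum_(f | P f) mu (w @^-1` [set f]))%E.
Proof.
have tF : trivIset [set` enum P] (fun f => w @^-1` [set f]).
  by move=> i j _ _ [x [<- <-]].
have := @integral_bigsetU_EFin _ _ _ mu _ (fun f => w @^-1` [set f]) (fun=> 1)
  (enum P) w_meas (enum_uniq _) tF.
rewrite /= bigsetU_fibers integral_cst ?mul1e; last exact: finite_valued_measurable.
move=> ->; last exact: measurable_cst.
by rewrite big_enum /=; apply: eq_bigr => f _; rewrite integral_cst ?mul1e.
Qed.

End finite_valued.

(** The functions form a product over the positions: one choice at the [n] prescribed ones, two
at each of the others. *)
Lemma card_ffun_prescribed m n (e : 'I_n -> 'I_m) (s : 'I_n -> bool) : injective e ->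
  (#|[pred f : {ffun 'I_m -> bool} | [forall i, f (e i) == s i]]| = 2 ^ (m - n))%N.
Proof.
move=> e_inj; pose F j := [pred b : bool | [forall i, (e i == j) ==> (b == s i)]].
have -> : #|[pred f : {ffun 'I_m -> bool} | [forall i, f (e i) == s i]]| =
    #|family F|.
  apply: eq_card => f; rewrite !inE; apply/forallP/familyP => [h j|h i].
    by rewrite inE; apply/forallP => i; apply/implyP => /eqP <-.
  by have := h (e i); rewrite inE => /forallP/(_ i)/implyP; apply.
rewrite card_family foldrE big_map big_enum /=.
rewrite (eq_bigr (fun j => if j \in codom e then 1%N else 2%N)); last first.
  move=> j _; case: ifPn => [/codomP[i ->]|je].
    rewrite -(card1 (s i)); apply: eq_card => b; rewrite !inE.
    apply/forallP/eqP => [/(_ i)|-> k]; first by rewrite eqxx => /eqP.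
    by apply/implyP => /eqP /e_inj ->.
  rewrite -card_bool; apply: eq_card => b; rewrite !inE; apply/forallP => i.
  by apply/implyP => /eqP ei; case/negP: je; rewrite -ei codom_f.
rewrite (bigID (mem (codom e))) /= big1 ?mul1n => [|j ->//].
rewrite (eq_bigr (fun=> 2%N)) => [|j /negPf->//].
rewrite prod_nat_const; congr (2 ^ _)%N.
have := cardC (mem (codom e)); rewrite card_codom// !card_ord => mE.
rewrite -[in RHS]mE addKn; exact: eq_card.
Qed.

Section digits.
Context {R : realType}.
Local Notation TR := (measurableTypeR R).

(** Lebesgue measure on the unit interval, seen as a measure on the line, so that its carrier
is an existing measurable type. *)
Definition unit_lebesgue : set TR -> \bar R :=
  mrestr lebesgue_measure (measurable_itv `[0%R, 1%R[).

HB.instance Definition _ := Measure.on unit_lebesgue.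

Lemma unit_lebesgue_setT : unit_lebesgue setT = 1%E.
Proof.
by rewrite /unit_lebesgue /mrestr setTI lebesgue_measure_itv /= lte_fin ltr01 sube0.
Qed.

Definition digit (i : nat) (t : R) : bool := odd (Num.trunc (2 ^+ i.+1 * t)).

(** The integer whose binary expansion is [s 0 ... s (n - 1)], most significant digit first. *)
Fixpoint dyadic_numerator (s : nat -> bool) n : nat :=
  if n is m.+1 then (s m + (dyadic_numerator s m).*2)%N else 0%N.

Lemma dyadic_numerator_lt s n : (dyadic_numerator s n < 2 ^ n)%N.
Proof. elim: n => //= n IH; rewrite expnS; case: (s n); lia. Qed.

Lemma trunc_half (x : R) : 0 <= x -> Num.trunc x = (Num.trunc (2 * x))./2.
Proof.
move=> x0; apply: truncn_def; have x20 : 0 <= 2 * x by rewrite mulr_ge0.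
have /andP[h1 h2] := truncn_itv x20; set m := Num.trunc (2 * x) in h1 h2 *.
have mE : m%:R = (odd m)%:R + 2 * (m./2)%:R :> R.
  by rewrite -{1}(odd_double_half m) natrD -mul2n natrM.
have : (odd m)%:R <= 1 :> R by case: (odd m).
have : 0 <= (odd m)%:R :> R by case: (odd m).
by move: h1 h2; rewrite -!natr1 mE => *; apply/andP; split; lra.
Qed.

(** The first [n] digits of [t] amount to the integer part of [2 ^ n * t]. *)
Lemma digits_prefix (s : nat -> bool) n (t : R) : 0 <= t < 1 ->
  (forall i, (i < n)%N -> digit i t = s i) <-> Num.trunc (2 ^+ n * t) = dyadic_numerator s n.
Proof.
move=> /andP[t0 t1]; elim: n => [|n IH].
  by split => // _; rewrite expr0 mul1r; apply: truncn_def; rewrite t0.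
have half : Num.trunc (2 ^+ n * t) = (Num.trunc (2 ^+ n.+1 * t))./2.
  by rewrite exprS -mulrA; apply: trunc_half; rewrite mulr_ge0 ?exprn_ge0.
split=> [h|h].
  have -> : Num.trunc (2 ^+ n.+1 * t) = (digit n t + (Num.trunc (2 ^+ n * t)).*2)%N.
    by rewrite half /digit odd_double_half.
  rewrite h//= (_ : Num.trunc _ = dyadic_numerator s n)//; apply/IH => i iN.
  by apply: h; exact: ltnW.
move=> i; rewrite ltnS leq_eqVlt => /predU1P[->|]; last first.
  move: i; apply/IH; rewrite half h /=; case: (s n); lia.
by rewrite /digit h /= oddD odd_double addbF; case: (s n).
Qed.

(** The union of the dyadic intervals with an odd numerator. A negative [t] has all its digits
equal to 0, and these intervals are positive. *)
Lemma digit_measurable i : measurable ([set t | digit i t] : set TR).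
Proof.
have -> : [set t | digit i t] = \bigcup_k
    `[(2 ^+ i.+1)^-1 * k.*2.+1%:R, (2 ^+ i.+1)^-1 * k.*2.+2%:R[%classic :> set R.
  apply/seteqP; split => t; rewrite /digit /=.
    set m := Num.trunc _ => mo; exists m./2 => //.
    have x0 : 0 <= 2 ^+ i.+1 * t.
      have : (0 < m)%N by case: m mo.
      by rewrite truncn_gt0 => /(le_trans ler01).
    have mE : m = (m./2).*2.+1 by rewrite -{1}(odd_double_half m) mo.
    have := truncn_itv x0; rewrite -/m {1 2}mE => /andP[h1 h2].
    by rewrite /= in_itv /= ler_pdivrMl ?ltr_pdivlMl ?exprn_gt0// h1 h2.
  move=> [k _ /=]; rewrite in_itv /= ler_pdivrMl ?ltr_pdivlMl ?exprn_gt0// => h.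
  by rewrite (truncn_def h) /= odd_double.
by apply: bigcupT_measurable => k; exact: measurable_itv.
Qed.

Lemma digit_eq_measurable i b : measurable ([set t | digit i t = b] : set TR).
Proof.
case: b; first exact: digit_measurable.
have -> : [set t : TR | digit i t = false] = ~` [set t | digit i t].
  by apply/seteqP; split => t /=; case: digit.
by apply: measurableC; exact: digit_measurable.
Qed.

(** The event is a dyadic interval of length [2 ^ (- n)]. *)
Lemma unit_lebesgue_digits (s : nat -> bool) n :
  unit_lebesgue [set t | forall i, (i < n)%N -> digit i t = s i] = ((2 ^- n)%:E)%E.
Proof.
set c := dyadic_numerator s n; have cn : (c < 2 ^ n)%N by exact: dyadic_numerator_lt.
have n0 : 0 < 2 ^+ n :> R by rewrite exprn_gt0.
rewrite /unit_lebesgue /mrestr.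
rewrite (_ : _ `&` _ = [set` `[(2 ^+ n)^-1 * c%:R, (2 ^+ n)^-1 * c.+1%:R[]); last first.
  apply/seteqP; split => t /=; rewrite !in_itv /= ler_pdivrMl// ltr_pdivlMl//.
    move=> [h t01]; have /andP[t0 _] := t01.
    rewrite /c -((digits_prefix s n t t01).1 h); apply: truncn_itv.
    by rewrite mulr_ge0// ltW.
  move=> h; have t01 : 0 <= t < 1.
    move/andP: h => [h1 h2]; rewrite -(pmulr_rge0 _ n0) (le_trans _ h1)//=.
    rewrite -(ltr_pM2l n0) mulr1 (lt_le_trans h2)//.
    by rewrite -natrX ler_nat.
  by split => //; apply/digits_prefix => //; exact: truncn_def.
rewrite lebesgue_measure_itv /= lte_fin ltr_pM2l ?invr_gt0// ltr_nat ltnSn.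
by rewrite -EFinB -mulrBr -natrB// subSnn mulr1.
Qed.

Lemma digits_event_measurable n (e : 'I_n -> nat) (s : 'I_n -> bool) :
  measurable ([set t | forall i, digit (e i) t = s i] : set TR).
Proof.
have -> : [set t : TR | forall i, digit (e i) t = s i] =
    \bigcap_(i in [set: 'I_n]) [set t | digit (e i) t = s i].
  by apply/seteqP; split => t /= H i => [_|]; exact: H.
by apply: fin_bigcap_measurable => // i _; exact: digit_eq_measurable.
Qed.

(** Arbitrary distinct digits are independent and fair: among the [2 ^ m] prefixes of length
[m], which are equally likely, [2 ^ (m - n)] fit the prescription. *)
Lemma unit_lebesgue_fair n (e : 'I_n -> nat) (s : 'I_n -> bool) : injective e ->
  unit_lebesgue [set t | forall i, digit (e i) t = s i] = ((2 ^- n)%:E)%E.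
Proof.
move=> e_inj; pose m := (\max_i e i).+1.
have em i : (e i < m)%N by rewrite ltnS leq_bigmax.
pose e' i := Ordinal (em i); have e'_inj : injective e' by move=> i j [/e_inj].
pose w (t : TR) : {ffun 'I_m -> bool} := [ffun j : 'I_m => digit j t].
have wE f : w @^-1` [set f] =
    [set t | forall i, (i < m)%N ->
       digit i t = (fun k => if insub k is Some j then f j else false) i].
  apply/seteqP; split => t /= h => [i im|].
    by rewrite insubT/= -h ffunE.
  by apply/ffunP => j; rewrite ffunE h// valK.
have w_meas f : measurable (w @^-1` [set f]).
  have -> : w @^-1` [set f] = [set t | forall j : 'I_m, digit j t = f j].
    apply/seteqP; split => t /= h; first by move=> j; rewrite -h ffunE.
    by apply/ffunP => j; rewrite ffunE h.
  exact: digits_event_measurable.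
pose P : pred {ffun 'I_m -> bool} := fun f => [forall i, f (e' i) == s i].
have -> : [set t | forall i, digit (e i) t = s i] = [set t : TR | P (w t)].
  apply/seteqP; split => t /= => [h|/forallP h i].
    by apply/forallP => i; rewrite ffunE h.
  by have := h i; rewrite ffunE => /eqP.
rewrite finite_valued_measure//.
rewrite (eq_bigr (fun=> (2 ^- m)%:E)) => [|f _]; last first.
  rewrite wE.
  exact: (unit_lebesgue_digits (fun k => if insub k is Some j then f j else false) m).
rewrite sumEFin; congr (_%:E); rewrite sumr_const card_ffun_prescribed//.
have nm : (n <= m)%N by have := leq_card _ e'_inj; rewrite !card_ord.
rewrite -[LHS]mulr_natl natrX -{2}(subnK nm) exprD invfM mulrA.
by rewrite divff ?mul1r// expf_neq0.
Qed.

(** A family of fair coins indexed by the integers; [pickle] enumerates them without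
repetition. *)
Definition bit (t : R) (i : int) : bool := digit (pickle i) t.

Definition bits_near (h : nat) (b : int -> bool) : {ffun 'I_h.*2.+1 -> bool} :=
  [ffun k : 'I_h.*2.+1 => b (k%:Z - h%:Z)].

Lemma bits_nearP h (b b' : int -> bool) : bits_near h b = bits_near h b' ->
  forall i : int, (`|i| <= h)%N -> b i = b' i.
Proof.
move=> bb' i ih; have lt : (absz (i + h%:Z)%R < h.*2.+1)%N by lia.
have /ffunP/(_ (Ordinal lt)) := bb'; rewrite !ffunE /=.
by have -> : (absz (i + h%:Z))%:Z - h%:Z = i by lia.
Qed.

(* [Q] is an event that depends only on the coins [- h], ..., [h]. *)
Variable h : nat.
Variable Q : (int -> bool) -> Prop.
Hypothesis Q_local : forall b b' : int -> bool,
  (forall i : int, (`|i| <= h)%N -> b i = b' i) -> Q b -> Q b'.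

Let Qb (f : {ffun 'I_h.*2.+1 -> bool}) := `[< exists2 b, Q b & bits_near h b = f >].

Let QbP (b : int -> bool) : Q b <-> Qb (bits_near h b).
Proof.
split => [Qb'|/asboolP[b' Qb' /bits_nearP e]]; first by apply/asboolP; exists b.
exact: Q_local Qb'.
Qed.

Let near_fiber (c : int) f :
  (fun t : TR => bits_near h (fun i => bit t (i + c))) @^-1` [set f] =
  [set t | forall k : 'I_h.*2.+1, digit (pickle (k%:Z - h%:Z + c)) t = f k].
Proof.
apply/seteqP; split => t /= => [<- k|H]; first by rewrite ffunE.
by apply/ffunP => k; rewrite ffunE; exact: H.
Qed.

Let near_fiber_measurable (c : int) f :
  measurable ((fun t : TR => bits_near h (fun i => bit t (i + c))) @^-1` [set f]).
Proof.
by rewrite near_fiber; exact: digits_event_measurable.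
Qed.

Lemma local_event_measurable (c : int) :
  measurable ([set t | Q (fun i => bit t (i + c))] : set TR).
Proof.
have -> : [set t | Q (fun i => bit t (i + c))] =
    [set t : TR | Qb (bits_near h (fun i => bit t (i + c)))].
  by apply/seteqP; split => t /= /QbP.
exact: finite_valued_measurable.
Qed.

(** An event that depends on finitely many coins has a probability that depends only on the
number of favourable patterns, which does not change under translation. *)
Lemma local_event_shift (c : int) :
  unit_lebesgue [set t | Q (fun i => bit t (i + c))] = unit_lebesgue [set t | Q (bit t)].
Proof.
have main c' : unit_lebesgue [set t | Q (fun i => bit t (i + c'))] =
    (\sum_(f | Qb f) (2 ^- h.*2.+1)%:E)%E.
  have -> : [set t | Q (fun i => bit t (i + c'))] =
      [set t : TR | Qb (bits_near h (fun i => bit t (i + c')))].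
    by apply/seteqP; split => t /= /QbP.
  rewrite finite_valued_measure//; apply: eq_bigr => f _.
  rewrite near_fiber; apply: unit_lebesgue_fair => i j /(pcan_inj pickleK) ij.
  by apply: val_inj => /=; lia.
rewrite main -(main 0); congr unit_lebesgue; apply/seteqP.
by split => t /=; apply: Q_local => i _; rewrite addr0.
Qed.

End digits.

(** * Random periodic concatenations *)
(** The measure structure of a pushforward depends on a proof of measurability of the map;
it is bundled here with that proof. *)
Definition image_measure {d d'} {T : measurableType d} {T' : measurableType d'}
    {R : realType} (mu : {measure set T -> \bar R}) (f : T -> T')
    (mf : measurable_fun [set: T] f) : {measure set T' -> \bar R} :=
  measure_function_pushforward__canonical__measure_function_Measure mu mf.

Definition shift_by {M : Type} (j : nat) (x : shift_space M) : shift_space M :=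
  fun n => x (n - j%:Z).

Lemma full_shift_by {M : Type} j (x : shift_space M) :
  full_shift (shift_by j x) = shift_by j.+1 x.
Proof. by apply/funext => n; rewrite /full_shift /shift_by; congr (x _); lia. Qed.

Lemma continuous_borel {R : realType} {T : ptopologicalType} (f : shift_space T -> R) :
  continuous f -> measurable_fun [set: shift_space T] f.
Proof.
move=> /continuousP fc.
apply: (@measurability _ _ (shift_space T) _ setT f _ (@RGenOInfty.measurableE R)).
move=> _ [_ [r ->] <-]; rewrite setTI; apply: open_borel; apply: fc.
exact: interval_open.
Qed.

Section borel_generation.
Context {R : realType} {M : pmetricType R}.
Notation X := (shift_space M).
Variable A : nat -> set M.
Hypothesis A_clopen : forall j, clopen (A j).
Hypothesis A_base : forall x U, nbhs x U -> exists j, A j x /\ A j `<=` U.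

(** This is how finite unions of cells generate the Borel sets: an open set is the countable
union, over the levels, of the cells that it contains. *)
Lemma open_bigcup_saturated (U : set X) : open U ->
  U = \bigcup_K [set x | forall y, same_cell A K x y -> U y].
Proof.
move=> oU; apply/seteqP; split => x; last by move=> [K _]; apply; exact: same_cell_refl.
move=> Ux; have [K HK] := cell_in_nbhs A A_base x U (open_nbhs_nbhs (conj oU Ux)).
by exists K.
Qed.

Lemma interior_cells_saturated (U : set X) K :
  saturated A K [set x | forall y, same_cell A K x y -> U y].
Proof. by move=> x y xy /= H z yz; apply: H; exact: same_cell_trans yz. Qed.

Lemma measurable_map_saturated {d} {T : measurableType d} (f : T -> X) :
  (forall K B, saturated A K B -> measurable (f @^-1` B)) ->
  measurable_fun [set: T] f.
Proof.
move=> H; apply: (@measurability _ _ T X [set: T] f (@open X)) => // _ [U oU <-].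
rewrite setTI (open_bigcup_saturated U oU) preimage_bigcup.
apply: bigcupT_measurable => K; apply: (H K); exact: interior_cells_saturated.
Qed.

(** The saturated sets are stable under intersection and generate the Borel sets. *)
Lemma measure_unique_saturated (m1 m2 : {measure set X -> \bar R}) :
  (m1 setT < +oo)%E ->
  (forall K B, saturated A K B -> m1 B = m2 B) ->
  forall B, measurable B -> m1 B = m2 B.
Proof.
move=> m1oo m12 B mB; pose G : set (set X) := [set B | exists K, saturated A K B].
apply: (@g_sigma_algebra_measure_unique _ R X G _ (fun=> setT)) => //.
- by move=> C [K]; exact: saturated_measurable.
- by move=> _; exists 0%N.
- by rewrite bigcup_const//; exists 0%N.
- move=> C D [K CK] [K' DK]; exists (maxn K K') => x y xy [Cx Dx]; split.
    by apply: CK Cx; apply: same_cellW xy; rewrite leq_maxl.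
  by apply: DK Dx; apply: same_cellW xy; rewrite leq_maxr.
- by move=> C [K]; exact: m12.
- move: B mB; apply: smallest_sub; first exact: smallest_sigma_algebra.
  move=> U oU; rewrite (open_bigcup_saturated U oU).
  apply: sigma_algebra_bigcup => K; apply: sub_sigma_algebra.
  by exists K; exact: interior_cells_saturated.
Qed.

End borel_generation.

Section coded_measure.
Context {R : realType} {M : pmetricType R}.
Notation X := (shift_space M).
Local Notation TR := (measurableTypeR R).
Variable A : nat -> set M.
Hypothesis A_clopen : forall j, clopen (A j).
Hypothesis A_base : forall x U, nbhs x U -> exists j, A j x /\ A j `<=` U.

Variables (L : nat) (p p' : M) (u : nat -> M).
Hypothesis L_gt0 : (0 < L)%N.

(** The word [u] of length [L] repeated over the line, with a coin in place of its first letter.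
The sign of [k] makes the coordinate 0 of the [m]-th shift the letter [m]: the shift moves
the coordinate [i] to [i + 1]. *)
Definition coded (b : int -> bool) : X := fun k =>
  if (- k %% L)%Z == 0 then (if b (- k %/ L)%Z then p else p')
  else u `|(- k %% L)%Z|%N.

Lemma coded_local (b b' : int -> bool) (n : int) : b (- n %/ L)%Z = b' (- n %/ L)%Z ->
  coded b n = coded b' n.
Proof. by rewrite /coded => ->. Qed.

Lemma coded_shift (b : int -> bool) :
  shift_by L (coded b) = coded (fun i => b (i + 1)).
Proof.
have L0 : L%:Z != 0 by rewrite -lt0n.
apply/funext => n; rewrite /shift_by /coded.
have -> : - (n - L%:Z) = 1 * L%:Z + - n by rewrite mul1r opprB.
by rewrite modzMDl divzMDl// addrC.
Qed.

(** The phase is [j] and the coins are the digits of [t]. *)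
Definition random_point (j : nat) (t : TR) : X := shift_by j (coded (bit t)).

(* Membership in a finite union of cells looks at finitely many coordinates, hence at
   finitely many coins. *)
Let saturated_local j K (B : set X) : saturated A K B ->
  exists h : nat, forall b b' : int -> bool,
    (forall i : int, (`|i| <= h)%N -> b i = b' i) ->
    B (shift_by j (coded b)) -> B (shift_by j (coded b')).
Proof.
move=> Bs; have [N HN] := same_cell_of_coordinates A K.
exists (N + j)%N => b b' bb'; apply: Bs; apply: HN => n nN.
apply: coded_local; apply: bb'; have := lez_div (- (n - j%:Z)) L%:Z.
by lia.
Qed.

Lemma random_point_measurable j : measurable_fun [set: TR] (random_point j).
Proof.
apply: (measurable_map_saturated A A_base _) => K B /(saturated_local j)[h Bh].
have -> : random_point j @^-1` B =
    [set t : TR | B (shift_by j (coded (fun i => bit t (i + 0))))].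
  by apply/seteqP; split => t /=; apply: Bh => i _; rewrite addr0.
exact: (@local_event_measurable R h (fun b => B (shift_by j (coded b)))).
Qed.

Definition random_point_law j : {measure set X -> \bar R} :=
  image_measure unit_lebesgue (random_point j) (random_point_measurable j).

(** Shifting by a whole period translates the coins by one, which preserves the probability of
every event that depends on finitely many coins. *)
Lemma random_point_law_period B : measurable B ->
  random_point_law L B = random_point_law 0 B.
Proof.
apply: (measure_unique_saturated A A_clopen A_base) => [|K {}B Bs].
  by rewrite /= /pushforward preimage_setT [ltLHS]unit_lebesgue_setT ltry.
have [h Bh] := saturated_local 0 K B Bs.
have := @local_event_shift R h (fun b => B (shift_by 0 (coded b))) Bh 1.
rewrite /= /pushforward => <-; congr unit_lebesgue; apply/seteqP.
have e t : random_point L t = shift_by 0 (coded (fun i => bit t (i + 1))).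
  by rewrite /random_point coded_shift; apply/funext => n; rewrite /shift_by subr0.
by split => t /=; rewrite e.
Qed.

Definition coded_average : set X -> \bar R :=
  mscale (L%:R^-1)%:nng (msum random_point_law L).

HB.instance Definition _ := Measure.on coded_average.

Lemma coded_averageE B :
  coded_average B = ((L%:R^-1)%:E * \sum_(j < L) random_point_law j B)%E.
Proof. by []. Qed.

Let coded_average_setT : coded_average setT = 1%E.
Proof.
rewrite coded_averageE (eq_bigr (fun=> 1%:E)) => [|j _]; last first.
  by rewrite /= /pushforward preimage_setT; exact: unit_lebesgue_setT.
rewrite sumEFin -EFinM sumr_const card_ord mulVf//.
by rewrite pnatr_eq0 -lt0n.
Qed.

HB.instance Definition _ :=
  Measure_isProbability.Build _ _ _ coded_average coded_average_setT.

(** The shift permutes the phases cyclically, since the phase [L] has the law of the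
phase 0. *)
Lemma coded_average_invariant B : measurable B ->
  coded_average (@full_shift M @^-1` B) = coded_average B.
Proof.
move=> mB; rewrite !coded_averageE; congr (_ * _)%E.
have step j : random_point_law j (@full_shift M @^-1` B) = random_point_law j.+1 B.
  rewrite /= /pushforward; congr unit_lebesgue; apply/seteqP.
  by split => t /=; rewrite /random_point full_shift_by.
rewrite (eq_bigr (fun j : 'I_L => random_point_law j.+1 B)) => [|j _]; last exact: step.
have := random_point_law_period B mB.
move: (random_point_law) L_gt0 => F; case: L => // l _ Fl.
by rewrite big_ord_recr big_ord_recl /= Fl addeC.
Qed.

Definition coded_invariant : invariant_probability M :=
  InvProb coded_average_invariant.

(** In phase [j] the coins [1], ..., [h] are written at the places [j - L], ..., [j - h L], at
distance at most [h L] from the origin. In the ball, the coordinate there is within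
[e <= mdist p p' / 2] of [y], so that [y] tells which of [p] and [p'] it is. *)
Lemma random_point_law_ball (a : R^nat) h (y : X) (e : R) j :
  (forall n, 0 <= a n) -> nondecreasing_seq a ->
  measurable (shift_ball a y e) ->
  (j < L)%N -> e * 2 <= mdist p p' -> e <= (a (h * L)%N + 1)^-1 ->
  (random_point_law j (shift_ball a y e) <= (2 ^- h)%:E)%E.
Proof.
move=> a0 a_incr mB jL epp' eh.
pose n (i : 'I_h) : int := j%:Z - (i.+1 * L)%:Z.
pose s (i : 'I_h) : bool := mdist (y (n i)) p < e.
pose k (i : 'I_h) : nat := pickle (i.+1%:Z : int).
rewrite -(unit_lebesgue_fair h k s); last first.
  by move=> i i' /(pcan_inj pickleK) [/val_inj].
rewrite /= /pushforward; apply: (le_measure (@unit_lebesgue R)); rewrite ?inE.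
- rewrite -[X in measurable X]setTI; apply: random_point_measurable => //; exact: mB.
- exact: digits_event_measurable.
move=> t /= Bt i.
have := shift_ball_coordinate a0 y _ e (n i) Bt.
have nL : (`|n i| <= h * L)%N.
  rewrite /n; have : (i.+1 * L <= h * L)%N by rewrite leq_mul2r ltn_ord orbT.
  have : (L <= i.+1 * L)%N by rewrite leq_pmull.
  by lia.
have an : a `|n i|%N <= a (h * L)%N by exact: a_incr.
have en : e <= (a `|n i|%N + 1)^-1.
  by apply: le_trans eh _; rewrite lef_pV2 ?posrE ?ltr_wpDl// lerD2r.
move=> /(_ en).
have L0 : L%:Z != 0 by rewrite -lt0n.
rewrite /random_point /shift_by /coded.
have -> : - (n i - j%:Z) = i.+1%:Z * L%:Z by rewrite /n PoszM; ring.
rewrite modzMl eqxx mulzK// -/(digit _ _).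
have -> : digit (k i) t = bit t i.+1%:Z by [].
case: (bit t _) => [yp|yp']; first by rewrite /s yp.
apply/esym/negbTE; rewrite -leNgt.
have := metric_triangle p (y (n i)) p'; rewrite (metric_sym p (y _)) => tri.
by lra.
Qed.

Lemma coded_average_ball (a : R^nat) h (y : X) (e : R) :
  (forall n, 0 <= a n) -> nondecreasing_seq a ->
  measurable (shift_ball a y e) ->
  e * 2 <= mdist p p' -> e <= (a (h * L)%N + 1)^-1 ->
  (coded_average (shift_ball a y e) <= (2 ^- h)%:E)%E.
Proof.
move=> a0 a_incr mB epp' eh; rewrite coded_averageE.
have L0 : L%:R != 0 :> R by rewrite pnatr_eq0 -lt0n.
apply: (@le_trans _ _ ((L%:R^-1)%:E * \sum_(j < L) (2 ^- h)%:E)%E).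
  apply: lee_wpmul2l; first by rewrite lee_fin invr_ge0.
  by apply: lee_sum => j _; apply: random_point_law_ball.
by rewrite sumEFin -EFinM sumr_const card_ord -[X in _ * X]mulr_natl mulrA mulVf// mul1r.
Qed.

Lemma integral_coded_average (g : X -> R) :
  measurable_fun [set: X] g -> (forall x, 0 <= g x) ->
  (\int[coded_average]_x (g x)%:E =
   \int[unit_lebesgue]_t (L%:R^-1 * \sum_(j < L) g (random_point j t))%:E)%E.
Proof.
move=> mg g0.
have mgE : measurable_fun [set: X] (EFin \o g) by apply/measurable_EFinP.
have mgj (j : 'I_L) : measurable_fun [set: TR] (fun t => (g (random_point j t))%:E).
  by apply/measurable_EFinP; apply: measurableT_comp => //; exact: random_point_measurable.
transitivity ((L%:R^-1)%:E * \int[msum random_point_law L]_x (g x)%:E)%E.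
  by apply: (ge0_integral_mscale (msum random_point_law L)) => // x _; rewrite lee_fin.
rewrite ge0_integral_measure_sum//; last by move=> x _; rewrite lee_fin.
under [RHS]eq_integral do rewrite EFinM -sumEFin.
rewrite ge0_integralZl//; last 2 first.
- exact: emeasurable_sum.
- by move=> t _; apply: sume_ge0 => j _; rewrite lee_fin.
congr (_ * _)%E; rewrite ge0_integral_sum//; last by move=> j t _; rewrite lee_fin.
apply: eq_bigr => j _.
rewrite (@ge0_integral_pushforward _ _ _ _ _ _ (random_point_measurable j))//.
by move=> x _; rewrite lee_fin.
Qed.

(** A bound valid for all outcomes of the coins is valid for the integral. *)
Lemma coded_average_le (f : X -> R) (B c : R) :
  measurable_fun [set: X] f -> (forall x, `|f x| <= B) ->
  (forall b, L%:R^-1 * \sum_(j < L) f (shift_by j (coded b)) <= c) ->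
  \int[coded_average]_x f x <= c.
Proof.
move=> mf fB fc; have L0 : L%:R != 0 :> R by rewrite pnatr_eq0 -lt0n.
(* Adding [B] makes the integrand nonnegative, and the change of variables then needs no
   integrability. *)
have mg : measurable_fun [set: X] (fun x => f x + B) by exact: measurable_funD.
have g0 x : 0 <= f x + B by have := fB x; rewrite ler_norml => /andP[]; lra.
have intf : coded_average.-integrable setT (EFin \o f).
  apply: measurable_bounded_integrable => //.
    by rewrite [ltLHS]coded_average_setT ltry.
  exists B; split; first exact: num_real.
  by move=> r Br x _; apply: le_trans (fB x) (ltW Br).
have intB : coded_average.-integrable setT (EFin \o cst B).
  exact: finite_measure_integrable_cst.
rewrite -(lerD2r B); have := @RintegralD _ _ _ coded_average setT f (cst B) measurableT intf intB.
rewrite Rintegral_cst// [fine _](_ : _ = 1) ?mulr1; last by rewrite [X in fine X]coded_average_setT.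
move=> <-; rewrite -lee_fin /Rintegral fineK; last first.
  exact: integrable_fin_num (integrableD measurableT intf intB).
rewrite [leLHS](integral_coded_average (fun x => f x + B) mg g0).
apply: (@le_trans _ _ (\int[unit_lebesgue]_t (cst (c + B)%:E t))%E).
  apply: ge0_le_integral_any => t _.
    by rewrite lee_fin mulr_ge0 ?invr_ge0// sumr_ge0.
  rewrite lee_fin big_split /= mulrDr sumr_const card_ord.
  rewrite -[X in _ + _ * X]mulr_natl mulrA mulVf// mul1r.
  by rewrite lerD2r; exact: fc.
by rewrite integral_cst// [X in (_ * X)%E]unit_lebesgue_setT mule1.
Qed.

End coded_measure.

(** * Sampling an invariant measure *)
(** Take [c l] equal to the integer part of [Q * p l] plus one, for a large [Q]. The total of
the [c l] exceeds [Q] by at most the cardinal of [F], so each frequency is off by at most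
[(1 + #|F| * p l) / Q], and all of them together by at most [2 * #|F| / Q]. *)
Lemma approximate_frequencies {R : realType} (F : finType) (p : F -> R) (d : R) :
  0 < d -> (forall l, 0 <= p l) -> \sum_l p l = 1 ->
  exists c : F -> nat, (0 < \sum_l c l)%N /\
    \sum_l `|(c l)%:R / (\sum_l c l)%:R - p l| <= d.
Proof.
move=> d0 p0 p1; pose s : R := #|F|%:R; pose Q := (Num.trunc (2 * s / d)).+1.
have s0 : 0 <= s by exact: ler0n.
have Q0 : 0 < Q%:R :> R by rewrite ltr0n.
pose c l := (Num.trunc (Q%:R * p l)).+1; exists c.
have cp l : Q%:R * p l <= (c l)%:R <= Q%:R * p l + 1.
  have /andP[h1 h2] := truncn_itv (mulr_ge0 (ltW Q0) (p0 l)).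
  by rewrite ltW//= /c -natr1 lerD2r.
have sc : (\sum_l c l)%:R = \sum_l (c l)%:R :> R by rewrite natr_sum.
have QE : Q%:R = \sum_l Q%:R * p l by rewrite -mulr_sumr p1 mulr1.
have QN : Q%:R <= (\sum_l c l)%:R :> R.
  rewrite sc QE; apply: ler_sum => l _.
  by have /andP[] := cp l.
have NQ : (\sum_l c l)%:R <= Q%:R + s :> R.
  rewrite sc QE /s -sum1_card natr_sum -big_split /=.
  by apply: ler_sum => l _; have /andP[] := cp l.
have N0 : 0 < (\sum_l c l)%:R :> R by exact: lt_le_trans QN.
split; first by rewrite -(ltr0n R).
apply: (@le_trans _ _ (\sum_l (1 + s * p l) / (\sum_l c l)%:R)).
  apply: ler_sum => l _; have -> : (c l)%:R / (\sum_l c l)%:R - p l =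
      ((c l)%:R - (\sum_l c l)%:R * p l) / (\sum_l c l)%:R.
    by rewrite mulrBl mulrAC divff ?gt_eqF// mul1r.
  rewrite normrM normfV (gtr0_norm N0) ler_pM2r ?invr_gt0//.
  have /andP[c1 c2] := cp l; have pl := p0 l.
  have : ((\sum_l c l)%:R - Q%:R) * p l <= s * p l by rewrite ler_wpM2r// lerBlDl.
  have : 0 <= ((\sum_l c l)%:R - Q%:R) * p l by rewrite mulr_ge0// subr_ge0.
  by rewrite mulrBl ler_norml => h1 h2; apply/andP; split; lra.
rewrite -mulr_suml big_split /= -mulr_sumr p1 mulr1 sumr_const -/s ler_pdivrMr//.
apply: le_trans (ler_wpM2l (ltW d0) QN); rewrite -ler_pdivrMl// mulrC.
have -> : s + s = 2 * s by ring.
by apply: ltW; rewrite truncnS_gt.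
Qed.

Lemma sum_flatten_nseq {R : pzRingType} {T : Type} (F : finType) (c : F -> nat) (z : F -> T)
    (g : T -> R) :
  \sum_(x <- flatten [seq nseq (c l) (z l) | l <- enum F]) g x = \sum_l (c l)%:R * g (z l).
Proof.
rewrite big_flatten big_map big_enum /=; apply: eq_bigr => l _.
by rewrite big_nseq iter_addr_0 mulr_natl.
Qed.

Lemma sum_blocks {R : nmodType} (N B : nat) (F : nat -> R) :
  \sum_(j < N * B) F j = \sum_(i < N) \sum_(r < B) F (i * B + r)%N.
Proof.
elim: N => [|N IH]; first by rewrite mul0n !big_ord0.
rewrite big_ord_recr /= -IH -(big_mkord xpredT F) -(big_mkord xpredT F) mulSn addnC.
rewrite (@big_cat_nat _ _ _ (N * B)) ?leq_addr//=; congr (_ + _).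
by rewrite -{1}[(N * B)%N]add0n big_addn addKn big_mkord; apply: eq_bigr => i _; rewrite addnC.
Qed.

Lemma count_near_ends (N B : nat) :
  (\sum_(r < B) ((r <= N) || (B <= r + N)) <= N.*2.+1)%N.
Proof.
apply: (@leq_trans (\sum_(0 <= r < B) (r <= N) + \sum_(0 <= r < B) (B <= r + N))).
  rewrite -big_split /= big_mkord; apply: leq_sum => r _.
  by case: (r <= N)%N; case: (B <= r + N)%N.
have h1 n : (\sum_(0 <= r < n) (r <= N) <= N.+1)%N && (\sum_(0 <= r < n) (r <= N) <= n)%N.
  elim: n => [|n IH]; first by rewrite big_nil.
  by rewrite big_nat_recr//=; move: IH; case: (leqP n N); lia.
have h2 n : (\sum_(0 <= r < n) (B <= r + N) <= n + N - B)%N.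
  elim: n => [|n IH]; first by rewrite big_nil.
  by rewrite big_nat_recr//=; move: IH; case: (leqP B (n + N)); lia.
by have := h2 B; have /andP[+ _] := h1 B; lia.
Qed.

Section shift_invariance.
Context {R : realType} {M : pmetricType R}.
Notation X := (shift_space M).

Lemma shift_by_continuous (r : nat) : continuous (@shift_by M r).
Proof.
move=> x; apply: (@ptws_cvg int M) => n.
exact: (@coordinate_continuous M (n - r%:Z) x).
Qed.

Lemma invariant_shift_by (mu : invariant_probability M) r (B : set X) :
  measurable B -> mu (shift_by r @^-1` B) = mu B.
Proof.
elim: r B => [|r IH] B mB.
  by congr (mu _); apply/seteqP; split => x; rewrite /shift_by /preimage /=;
    congr B; apply/funext => n; rewrite subr0.
case: mu IH => m mT IH /=.
have mTB : measurable (@full_shift M @^-1` B).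
  rewrite -[X in measurable X]setTI.
  apply: (@measurability _ _ X X [set: X] (@full_shift M) (@open X)) mB => //.
  move=> _ [U oU <-]; rewrite setTI; apply: open_borel.
  have -> : @full_shift M = shift_by 1 by apply/funext => x; apply/funext.
  by move/continuousP : (shift_by_continuous 1); apply.
rewrite -(mT B mB) -(IH _ mTB); congr (m _); apply/seteqP.
by split => x; rewrite /preimage /= full_shift_by.
Qed.

Lemma bounded_continuous_integrable (mu : probability X R) (f : X -> R) (B : R) :
  continuous f -> (forall x, `|f x| <= B) -> mu.-integrable setT (EFin \o f).
Proof.
move=> fc fB; apply: measurable_bounded_integrable => //.
- by rewrite [ltLHS](@probability_setT _ _ _ mu) ltry.
- exact: continuous_borel.
- exists B; split; first exact: num_real.
  by move=> r Br x _; apply: le_trans (fB x) (ltW Br).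
Qed.

Lemma Rintegral_shift_by (mu : invariant_probability M) r (f : X -> R) (B : R) :
  continuous f -> (forall x, `|f x| <= B) ->
  \int[mu]_x f (shift_by r x) = \int[mu]_x f x.
Proof.
move=> fc fB; have mS : measurable_fun [set: X] (@shift_by M r).
  apply: (@measurability _ _ X X [set: X] (@shift_by M r) (@open X)) => //.
  move=> _ [U oU <-]; rewrite setTI; apply: open_borel.
  by move/continuousP : (shift_by_continuous r); apply.
rewrite /Rintegral; congr fine.
rewrite -(@integral_pushforward _ _ _ _ _ _ mS mu setT (EFin \o f))//=; last 2 first.
- by apply/measurable_EFinP; exact: continuous_borel.
- apply: (bounded_continuous_integrable mu (f \o shift_by r) B); last by move=> x; exact: fB.
  by move=> x; apply: continuous_comp; [exact: shift_by_continuous|exact: fc].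
by apply: eq_measure_integral => C mC _; exact: (invariant_shift_by mu r C mC).
Qed.

End shift_invariance.

Section approximation.
Context {R : realType} {M : pmetricType R}.
Notation X := (shift_space M).
Hypothesis M_compact : compact [set: M].
Variable A : nat -> set M.
Hypothesis A_clopen : forall j, clopen (A j).
Hypothesis A_base : forall x U, nbhs x U -> exists j, A j x /\ A j `<=` U.

(** Uniform continuity of the first [B] iterates of the shift. *)
Lemma uniform_same_cell_shifts k B : exists K, forall x y, same_cell A K x y ->
  forall r, (r < B)%N -> same_cell A k (shift_by r x) (shift_by r y).
Proof.
elim: B => [|B [K HK]]; first by exists 0%N.
have [K' HK'] : exists K, forall x y, same_cell A K x y ->
    same_cell A k (shift_by B x) (shift_by B y).
  apply: (uniform_same_cell M_compact A A_clopen) => x.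
  have := shift_by_continuous B x _ (cell_nbhs A A_clopen k (shift_by B x)).
  move=> /(cell_in_nbhs A A_base)[K' HK']; exists K' => y z /HK' xy /HK' xz.
  exact: same_cell_trans (same_cell_sym _ _ _ _ xy) xz.
exists (maxn K K') => x y xy r; rewrite ltnS leq_eqVlt => /predU1P[->|rB].
  by apply: HK'; apply: same_cellW xy; rewrite leq_maxr.
by apply: HK rB; apply: same_cellW xy; rewrite leq_maxl.
Qed.

(** A function that is almost constant on the cells has almost the integral of the
corresponding step function. *)
Lemma Rintegral_label_close (mu : probability X R) K (h : X -> R)
    (v : {ffun 'I_K -> bool} -> R) (w B : R) :
  continuous h -> (forall x, `|h x| <= B) ->
  (forall x, `|h x - v (label A K x)| <= w) ->
  `|\int[mu]_x h x - \sum_l v l * fine (mu (cell A K l))| <= w.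
Proof.
move=> hc hB hv.
have ih : mu.-integrable setT (EFin \o h) by exact: bounded_continuous_integrable hB.
have iv : mu.-integrable setT (EFin \o (v \o label A K)).
  apply: measurable_bounded_integrable => //.
  - by rewrite [ltLHS](@probability_setT _ _ _ mu) ltry.
  - exact: measurable_label.
  - exists (B + w); split; first exact: num_real.
    move=> r Br x _; apply: le_trans (ltW Br); rewrite /=.
    have -> : v (label A K x) = h x - (h x - v (label A K x)) by ring.
    by rewrite (le_trans (ler_normB _ _))// lerD.
have -> : \sum_l v l * fine (mu (cell A K l)) = \int[mu]_x (v (label A K x)).
  rewrite /Rintegral (integral_label A A_clopen mu K v).
  rewrite (eq_bigr (fun l => (v l * fine (mu (cell A K l)))%:E)) ?sumEFin//.
  by move=> l _; rewrite EFinM fineK// fin_num_measure//; exact: cell_measurable.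
rewrite -(@RintegralB _ _ _ mu setT h (v \o label A K) measurableT ih iv).
have iB := integrableB measurableT ih iv.
apply: le_trans (le_normr_Rintegral measurableT _) _ => //.
have -> : w = \int[mu]_x cst w x.
  by rewrite Rintegral_cst// [fine _](_ : _ = 1) ?mulr1// [X in fine X](@probability_setT _ _ _ mu).
apply: le_Rintegral => //.
- exact: (integrable_abse iB).
- exact: finite_measure_integrable_cst.
Qed.

Variables (p p' : M).

(** Cut the average over a period of [L = N * L0] phases into [N] blocks of length [L0].
Inside the block [i], and away from its ends, the coded point looks like the orbit of the
sample point number [i]. For each [r], the samples shifted by [r] have a mean close to the
integral of [f], by invariance of [mu] and the choice of the frequencies. The coins and the
junctions of the blocks affect only phases near the ends of the blocks, which form a
proportion at most [1 / (k + 1)]. One error [w] comes from comparing [mu] with the samples,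
the other from comparing the samples with the coded point. *)
Lemma coded_approximation (mu : invariant_probability M) (k : nat) :
  exists (L : nat) (u : nat -> M), (0 < L)%N /\
  forall (f : X -> R) (B w : R), continuous f -> (forall x, `|f x| <= B) ->
    (forall x y, same_cell A k x y -> `|f x - f y| <= w) ->
    forall b, `|L%:R^-1 * \sum_(j < L) f (shift_by j (coded L p p' u b)) - \int[mu]_x f x|
      <= w + w + 3 * B / k.+1%:R.
Proof.
have [N0 HN0] := same_cell_of_coordinates A k.
(* A cell of level [k] is decided by the coordinates up to [N0], so at most [2 * N0 + 1] phases
   of a block see beyond its ends, out of [L0]. *)
pose L0 := (k.+1 * N0.*2.+1)%N; have L0_gt0 : (0 < L0)%N by rewrite muln_gt0.
have [K HK] := uniform_same_cell_shifts k L0.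
pose P l := fine (mu (cell A K l)).
have P0 l : 0 <= P l by exact: fine_ge0.
have P1 : \sum_l P l = 1.
  apply: EFin_inj; rewrite -sumEFin -(sum_measure_cells A A_clopen mu K).
  by apply: eq_bigr => l _; rewrite fineK// fin_num_measure//; exact: cell_measurable.
have k0 : 0 < k.+1%:R^-1 :> R by rewrite invr_gt0.
have [c [c_gt0 Hc]] := approximate_frequencies _ P _ k0 P0 P1.
pose z (l : {ffun 'I_K -> bool}) : X := get (cell A K l).
have zP x : same_cell A K x (z (label A K x)).
  apply/(labelP A K); have : cell A K (label A K x) (z (label A K x)).
    exact: (@getI _ (cell A K (label A K x)) x erefl).
  by rewrite /cell /=.
pose zs := flatten [seq nseq (c l) (z l) | l <- enum {ffun 'I_K -> bool}].
pose N := (\sum_l c l)%N.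
have size_zs : size zs = N.
  rewrite size_flatten /shape -map_comp sumnE big_map big_enum /=.
  by apply: eq_bigr => l _; rewrite size_nseq.
pose L := (N * L0)%N; have L_gt0 : (0 < L)%N by rewrite muln_gt0 c_gt0.
(* The letters are read backwards in the sample: its coordinate [- r] is the coordinate 0 of
   its [r]-th shift. *)
pose u m : M := nth point zs (m %/ L0) (- (m %% L0)%:Z).
exists L, u; split => // f B w fc fB fw b; set x := coded L p p' u b.
have B0 : 0 <= B by exact: le_trans (fB point).
have w0 : 0 <= w by exact: le_trans (fw point point (same_cell_refl _ _ _)).
pose bad r := (r <= N0)%N || (L0 <= r + N0)%N.
have agree i r : (i < N)%N -> (r < L0)%N -> ~~ bad r ->
    same_cell A k (shift_by (i * L0 + r) x) (shift_by r (nth point zs i)).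
  move=> iN rL; rewrite negb_or -!ltnNge => /andP[Nr rN]; apply: HN0 => n nN.
  rewrite /shift_by /x /coded; set m := absz (r%:Z - n).
  have mE : m%:Z = r%:Z - n by rewrite /m; lia.
  have mL : (m < L0)%N by lia.
  have -> : - (n - (i * L0 + r)%N%:Z) = (i * L0 + m)%N%:Z.
    by rewrite !PoszD mE; ring.
  have qL : (i * L0 + m < L)%N.
    rewrite /L; apply: (@leq_trans (i.+1 * L0)); rewrite ?leq_mul2r ?iN ?orbT//.
    by rewrite mulSn addnC ltn_add2r.
  rewrite modz_nat modn_small//; case: eqP => [q0|_]; first by lia.
  rewrite absz_nat /u divnMDl// divn_small// addn0 modnMDl modn_small//.
  by congr (nth point zs i _); rewrite mE; ring.
(* [T r] is the mean of [f] over the samples shifted by [r], and [D i r] below is the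
   discrepancy between the coded point and the sample in the phase [r] of the block [i]. *)
pose T r := N%:R^-1 * \sum_(i < N) f (shift_by r (nth point zs i)).
set I := \int[mu]_y f y.
have N0R : N%:R != 0 :> R by rewrite pnatr_eq0 -lt0n.
have L0R : L0%:R != 0 :> R by rewrite pnatr_eq0 -lt0n.
have TI r : (r < L0)%N -> `|T r - I| <= w + B / k.+1%:R.
  move=> rL; have TE : T r = \sum_l (c l)%:R / N%:R * f (shift_by r (z l)).
    rewrite /T -size_zs -(big_mkord xpredT (fun i => f (shift_by r (nth point zs i)))).
    rewrite -(big_nth point xpredT (fun y => f (shift_by r y))) size_zs.
    rewrite (@sum_flatten_nseq R X _ c z (fun y => f (shift_by r y))) mulr_sumr.
    by apply: eq_bigr => l _; rewrite mulrA [_^-1 * _]mulrC.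
  have I_close : `|I - \sum_l f (shift_by r (z l)) * P l| <= w.
    rewrite /I -(Rintegral_shift_by mu r f B fc fB).
    apply: (Rintegral_label_close mu K (f \o shift_by r) (fun l => f (shift_by r (z l))) w B).
    - by move=> y; apply: continuous_comp; [exact: shift_by_continuous|exact: fc].
    - by move=> y; exact: fB.
    - by move=> y; apply: fw; apply: HK rL; exact: zP.
  have -> : T r - I = \sum_l ((c l)%:R / N%:R - P l) * f (shift_by r (z l)) -
      (I - \sum_l f (shift_by r (z l)) * P l).
    have -> : \sum_l ((c l)%:R / N%:R - P l) * f (shift_by r (z l)) =
        T r - \sum_l f (shift_by r (z l)) * P l.
      by rewrite TE -sumrB; apply: eq_bigr => l _; ring.
    by ring.
  apply: le_trans (ler_normB _ _) _; rewrite addrC lerD//.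
  apply: le_trans (ler_norm_sum _ _ _) _.
  apply: (@le_trans _ _ (\sum_l `|(c l)%:R / N%:R - P l| * B)).
    by apply: ler_sum => l _; rewrite normrM ler_wpM2l.
  by rewrite -mulr_suml mulrC ler_wpM2l.
pose D i r := f (shift_by (i * L0 + r) x) - f (shift_by r (nth point zs i)).
have DB i r : (i < N)%N -> (r < L0)%N -> `|D i r| <= w + 2 * B * (bad r)%:R.
  move=> iN rL; case: (boolP (bad r)) => br; last by rewrite mulr0 addr0; apply: fw; exact: agree.
  rewrite mulr1; apply: le_trans (ler_normB _ _) _.
  have := fB (shift_by (i * L0 + r) x); have := fB (shift_by r (nth point zs i)).
  by move: w0; lra.
have -> : L%:R^-1 * \sum_(j < L) f (shift_by j x) - I =
    L%:R^-1 * \sum_(i < N) \sum_(r < L0) D i r + L0%:R^-1 * \sum_(r < L0) (T r - I).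
  rewrite (sum_blocks N L0 (fun j => f (shift_by j x))).
  have -> : \sum_(r < L0) (T r - I) = \sum_(r < L0) T r - L0%:R * I.
    by rewrite sumrB sumr_const card_ord mulr_natl.
  have -> : \sum_(i < N) \sum_(r < L0) D i r =
      \sum_(i < N) \sum_(r < L0) f (shift_by (i * L0 + r) x) - N%:R * \sum_(r < L0) T r.
    have -> : N%:R * \sum_(r < L0) T r =
        \sum_(i < N) \sum_(r < L0) f (shift_by r (nth point zs i)).
      by rewrite /T -mulr_sumr mulrA mulfV// mul1r exchange_big.
    by rewrite -sumrB; apply: eq_bigr => i _; rewrite -sumrB.
  rewrite /L natrM; field; by rewrite N0R L0R.
apply: le_trans (ler_normD _ _) _; rewrite !normrM !normfV !normr_nat.
have LN : L%:R = N%:R * L0%:R :> R by rewrite natrM.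
have kR : k.+1%:R != 0 :> R by rewrite pnatr_eq0.
have first_part : L%:R^-1 * `|\sum_(i < N) \sum_(r < L0) D i r| <= w + 2 * B / k.+1%:R.
  rewrite mulrC ler_pdivrMr ?ltr0n//; apply: le_trans (ler_norm_sum _ _ _) _.
  apply: (@le_trans _ _ (\sum_(i < N) (L0%:R * w + 2 * B * N0.*2.+1%:R))).
    apply: ler_sum => i _; apply: le_trans (ler_norm_sum _ _ _) _.
    apply: (@le_trans _ _ (\sum_(r < L0) (w + 2 * B * (bad r)%:R))).
      by apply: ler_sum => r _; exact: DB.
    rewrite big_split /= sumr_const card_ord -[w *+ L0]mulr_natl lerD2l -mulr_sumr.
    by rewrite ler_wpM2l ?mulr_ge0// -natr_sum ler_nat count_near_ends.
  rewrite sumr_const card_ord -[leLHS]mulr_natl LN /L0 natrM.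
  rewrite le_eqVlt; apply/orP; left; apply/eqP.
  by move: (k.+1%:R : R) kR => t t0; field.
have second_part : L0%:R^-1 * `|\sum_(r < L0) (T r - I)| <= w + B / k.+1%:R.
  rewrite mulrC ler_pdivrMr ?ltr0n//; apply: le_trans (ler_norm_sum _ _ _) _.
  apply: (@le_trans _ _ (\sum_(r < L0) (w + B / k.+1%:R))).
    by apply: ler_sum => r _; exact: TI.
  by rewrite sumr_const card_ord -[leLHS]mulr_natr.
apply: le_trans (lerD first_part second_part) _.
rewrite le_eqVlt; apply/orP; left; apply/eqP.
by move: (k.+1%:R : R) kR => t t0; field.
Qed.

End approximation.

(** * Density *)
(** The weak topology is induced by the evaluation on all test functions, with values in a
space of pointwise convergence. *)
Lemma weak_cvg {R : realType} {M : pmetricType R}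
    (nu : nat -> invariant_probability M) (mu : invariant_probability M) :
  (forall f : bounded_continuous M,
    \int[nu k]_x sval f x @[k --> \oo] --> \int[mu]_x sval f x) ->
  nu @ \oo --> mu.
Proof.
move=> H; have cvI : (fun k => integral_eval (nu k)) @ \oo --> integral_eval mu.
  exact: ptws_cvg.
move=> V [_ [[C oC <-] Cmu sV]]; apply: filterS sV _.
by apply: cvI; exact: open_nbhs_nbhs.
Qed.

Section density.
Context {R : realType} {M : pmetricType R} {a : R^nat}.
Notation X := (shift_space M).
Hypothesis M_compact : compact [set: M].
Hypothesis a_ge0 : forall n, 0 <= a n.
Hypothesis a_incr : nondecreasing_seq a.
Hypothesis a_summable : cvgn (series (fun k => (a k + 1)^-1)).
Hypothesis a_subexp : forall alpha : R, 0 < alpha ->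
  a k / expR (alpha * k%:R) @[k --> \oo] --> (0 : R).
Variable A : nat -> set M.
Hypothesis A_clopen : forall j, clopen (A j).
Hypothesis A_base : forall x U, nbhs x U -> exists j, A j x /\ A j `<=` U.
Variables (p p' : M).
Hypothesis pp' : p != p'.

(** With [e = exp (- alpha * k)] and [k = h * L] large, [a k <= exp (alpha * k) / 2] and
[exp (alpha * k) >= 2] add up to [a k + 1 <= 1 / e]. *)
Lemma subexponential_scales (L : nat) (alpha d : R) : (0 < L)%N -> 0 < alpha -> 0 < d ->
  exists h : nat, [/\ (0 < h)%N, expR (- (alpha * (h * L)%N%:R)) < d &
    expR (- (alpha * (h * L)%N%:R)) <= (a (h * L)%N + 1)^-1].
Proof.
move=> L0 al0 d0.
have /cvgrPdist_lt/(_ 2^-1) := a_subexp _ al0.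
rewrite invr_gt0 ltr0n => /(_ isT)[N _ HN].
pose d' := Num.min d 2^-1; have d'0 : 0 < d' by rewrite lt_min d0 invr_gt0 ltr0n.
pose h := (maxn N (Num.trunc (alpha * d')^-1)).+1.
exists h; set k := (h * L)%N; have hk : (h <= k)%N by rewrite leq_pmulr.
have Nk : (N <= k)%N by apply: leq_trans hk; rewrite leqW// leq_maxl.
have ed : expR (- (alpha * k%:R)) < d'.
  rewrite expRN -[ltRHS]invrK ltf_pV2 ?posrE ?expR_gt0 ?invr_gt0//.
  apply: lt_le_trans (expR_ge1Dx _); apply: ltr_wpDl => //.
  rewrite -ltr_pdivrMl// -invfM; apply: lt_le_trans (truncnS_gt _) _.
  by rewrite ler_nat; apply: leq_trans hk; rewrite ltnS leq_maxr.
split=> //; first by apply: lt_le_trans ed _; rewrite ge_min lexx.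
have := HN k Nk; rewrite /= sub0r normrN ger0_norm; last by rewrite divr_ge0 ?expR_ge0.
rewrite ltr_pdivrMr ?expR_gt0// => ak.
have e2 : expR (- (alpha * k%:R)) < 2^-1 by apply: lt_le_trans ed _; rewrite ge_min lexx orbT.
rewrite expRN in e2 *; have E0 := expR_gt0 (alpha * k%:R).
have e1 : 2 < expR (alpha * k%:R) by move: e2; rewrite ltf_pV2 ?posrE.
rewrite lef_pV2 ?posrE ?ltr_wpDl//.
by lra.
Qed.

(** At the scale [e = exp (- alpha * h * L)] every ball has measure at most [2 ^ (- h)], which
is less than [e ^ n] when [n * alpha * L < ln 2]. *)
Lemma coded_upper_fractal_dim (L : nat) (u : nat -> M) (L_gt0 : (0 < L)%N) (q : R) :
  1 < q ->
  upper_fractal_dim a (coded_invariant A A_clopen A_base L p p' u L_gt0) q = +oo%E.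
Proof.
move=> q1; apply/upper_fractal_dim_pinftyP => // n.
set nu := coded_invariant _ _ _ _ _ _ _ _.
pose alpha : R := ln 2 / (2 * L%:R * n.+1%:R).
have LR : 0 < L%:R :> R by rewrite ltr0n.
have nR : 0 < n.+1%:R :> R by rewrite ltr0n.
have ln20 : 0 < ln 2 :> R by rewrite ln_gt0// ltr1n.
have al0 : 0 < alpha by rewrite divr_gt0// !mulr_gt0.
have pp0 : 0 < mdist p p' / 2 by rewrite divr_gt0// mdist_gt0.
have d0 : 0 < Num.min n.+1%:R^-1 (mdist p p' / 2) by rewrite lt_min invr_gt0 nR.
have [h [h0 hd ha]] := subexponential_scales L alpha _ L_gt0 al0 d0.
set e := expR _ in hd ha; exists e; have e0 : 0 < e by exact: expR_gt0.
move: hd; rewrite lt_min => /andP[en epp]; split; first by rewrite e0 en.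
have q0 : 0 < q - 1 by rewrite subr_gt0.
have mB (y : X) : measurable (shift_ball a y e).
  by apply: open_borel; exact: (shift_ball_open a_ge0 a_summable A A_clopen A_base).
have nuB (y : X) : (nu (shift_ball a y e) <= (2 ^- h)%:E)%E.
  have e2 : e * 2 <= mdist p p' by rewrite -ler_pdivlMr// ltW.
  exact: (coded_average_ball A A_base L p p' u L_gt0 a h y e a_ge0 a_incr (mB y) e2 ha).
have h2 : 0 <= 2 ^- h :> R by rewrite invr_ge0 exprn_ge0.
apply: (@le_lt_trans _ _ ((2 ^- h) `^ (q - 1))%:E).
  apply: (@le_trans _ _ (\int[nu]_(x in msupp nu) cst ((2 ^- h) `^ (q - 1))%:E x)%E).
    apply: ge0_le_integral_any => x _; first exact: poweR_ge0.
    rewrite -[nu _]fineK ?fin_num_measure// poweR_EFin lee_fin.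
    rewrite ge0_ler_powR ?nnegrE ?fine_ge0 ?(ltW q0)//.
    by rewrite -lee_fin fineK ?fin_num_measure.
  have ms := msupp_measurable A A_clopen A_base nu.
  rewrite integral_cst//; apply: (@le_trans _ _ (((2 ^- h) `^ (q - 1))%:E * 1)%E).
    by apply: lee_wpmul2l; [rewrite lee_fin powR_ge0|exact: probability_le1].
  by rewrite mule1.
have key : n%:R * (alpha * (h * L)%N%:R) < h%:R * ln 2.
  have -> : n%:R * (alpha * (h * L)%N%:R) = n%:R / (2 * n.+1%:R) * (h%:R * ln 2).
    rewrite /alpha natrM; move: (L%:R : R) LR (n.+1%:R : R) nR => x x0 y y0.
    by field; rewrite !gt_eqF.
  rewrite gtr_pMl ?mulr_gt0 ?ltr0n// ltr_pdivrMr ?mulr_gt0// mul1r -natr1.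
  by have := ler0n R n; lra.
have h20 : 0 < 2 ^- h :> R by rewrite invr_gt0 exprn_gt0.
have ln2h : ln (2 ^- h) = - (h%:R * ln 2) :> R.
  by rewrite lnV ?posrE ?exprn_gt0// lnXn// mulr_natl.
rewrite lte_fin /powR !gt_eqF// ltr_expR ln2h /e expRK.
rewrite [n%:R * _]mulrC -mulrA ltr_pM2l// mulrN ltrN2.
exact: key.
Qed.

(** The [k]-th approximation of [mu] is built from [k] alone, before any test function is
chosen: a given function oscillates little on the cells of level [k] as soon as [k] is large,
so the sequence converges weakly to [mu]. *)
Lemma infinite_dim_dense (q : R) : 1 < q ->
  dense [set mu : invariant_probability M | upper_fractal_dim a mu q = +oo%E].
Proof.
move=> q1 U [mu Umu] oU.
have ex (k : nat) : exists nu : invariant_probability M,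
    upper_fractal_dim a nu q = +oo%E /\
    forall (f : X -> R) (B w : R), continuous f -> (forall x, `|f x| <= B) ->
      (forall x y, same_cell A k x y -> `|f x - f y| <= w) ->
      `|\int[nu]_x f x - \int[mu]_x f x| <= w + w + 3 * B / k.+1%:R.
  have [L [u [L_gt0 Hu]]] := coded_approximation M_compact A A_clopen A_base p p' mu k.
  exists (coded_invariant A A_clopen A_base L p p' u L_gt0).
  split; first exact: coded_upper_fractal_dim.
  move=> f B w fc fB fw; have H := Hu f B w fc fB fw.
  have mf := continuous_borel f fc.
  have mfN := continuous_borel (fun x => - f x) (fun x => continuousN (fc x)).
  set e := w + w + 3 * B / k.+1%:R in H *.
  rewrite ler_distl; apply/andP; split; last first.
    apply: (coded_average_le A A_base L p p' u L_gt0 f B) => // b.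
    by have := H b; rewrite ler_distl => /andP[].
  have intf := bounded_continuous_integrable
    (coded_invariant A A_clopen A_base L p p' u L_gt0) f B fc fB.
  (* The lower bound is the upper bound for the opposite function. *)
  rewrite -lerN2 opprB -mulN1r -RintegralZl//.
  apply: (coded_average_le A A_base L p p' u L_gt0 (fun x => -1 * f x) B).
  - by under eq_fun do rewrite mulN1r.
  - by move=> x; rewrite mulN1r normrN.
  move=> b; have := H b; rewrite ler_distl => /andP[h _].
  by rewrite -mulr_sumr mulrCA mulN1r lerNl opprB.
have [nu Hnu] := choice ex.
have nu_mu : nu @ \oo --> mu.
  apply: weak_cvg => -[f [fc [B0 [_ fB]]]] /=; apply/cvgrPdist_le => e e0.
  pose B := Num.max (B0 + 1) 1.
  have B_gt0 : 0 < B by rewrite lt_max ltr01 orbT.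
  have fBB x : `|f x| <= B by apply: fB => //; rewrite lt_max ltrDl ltr01.
  have e30 : 0 < e / 3 by rewrite divr_gt0.
  have [K HK] := uniform_oscillation M_compact A A_clopen A_base f _ fc e30.
  pose N := Num.trunc (3 * B / (e / 3)).
  exists (maxn K N) => // k /=; rewrite geq_max => /andP[Kk Nk].
  have [_ H] := Hnu k; rewrite distrC.
  apply: le_trans (H f B (e / 3) fc fBB _) _.
    by move=> x y xy; apply: HK; exact: same_cellW xy.
  have : 3 * B / k.+1%:R <= e / 3.
    rewrite ler_pdivrMr ?ltr0n// -ler_pdivrMl// [leLHS]mulrC ltW//.
    by apply: lt_le_trans (truncnS_gt _) _; rewrite ler_nat ltnS.
  move=> hX; apply: (@le_trans _ _ (e / 3 + e / 3 + e / 3)); first by rewrite lerD2l.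
  rewrite le_eqVlt; apply/orP; left; apply/eqP.
  by move: (e : R) => t; field.
have [k _ Hk] : \forall k \near \oo, U (nu k) by apply: nu_mu; exact: open_nbhs_nbhs.
exists (nu k); split; first by apply: Hk => /=.
by have [] := Hnu k.
Qed.

End density.

Theorem theorem1p3 (R : realType) (M : pmetricType R) (a : R^nat)
    (M_compact : compact [set: M])
    (M_countably_infinite : ([set: M] #= [set: nat])%card)
    (a_ge0 : forall n, 0 <= a n)
    (a_incr : nondecreasing_seq a)
    (a_summable : cvgn (series (fun k => (a k + 1)^-1)))
    (a_subexp : forall alpha : R, 0 < alpha ->
       a k / expR (alpha * k%:R) @[k --> \oo] --> (0 : R)) :
  (forall q : R, 1 < q ->
     let S := [set mu : invariant_probability M |
                upper_fractal_dim a mu q = +oo%E] in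
     dense S /\ Gdelta S) /\
  residual [set mu : invariant_probability M | upper_entropy_dim a mu = +oo%E].
Proof.
have M_countable : countable [set: M].
  by rewrite /countable; move: M_countably_infinite; rewrite card_eq_le => /andP[].
have [p [p' pp']] : exists p p' : M, p != p'.
  apply: contrapT => /forallNP H.
  have [f [_ finj _]] : exists f : nat -> M, set_bij [set: nat] [set: M] f.
    by apply/card_set_bijP; rewrite card_eq_sym.
  have := H (f 0%N) => /forallNP/(_ (f 1%N)) /negP; rewrite negbK => /eqP f01.
  by have /= := finj 0%N 1%N (mem_set I) (mem_set I) f01.
have [A [A_clopen A_base]] := countable_clopen_base M_countable.
have S_dense q (q1 : 1 < q) := infinite_dim_dense M_compact a_ge0 a_incr a_summable
  a_subexp A A_clopen A_base p p' pp' q q1.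
have S_eq q (q1 : 1 < q) := upper_fractal_dim_pinfty_Gdelta M_compact a_ge0 a_summable
  A A_clopen A_base q q1.
have S_open q n (q1 : 1 < q) : open (small_cell_moment A (a := a) q n).
  exact: small_cell_moment_open.
split=> [q q1 S|].
  split; first exact: S_dense.
  by exists (small_cell_moment A (a := a) q) => [n|]; [exact: S_open|exact: S_eq].
have q2 : 1 < 2 :> R by rewrite ltr1n.
exists [set mu : invariant_probability M | upper_fractal_dim a mu 2 = +oo%E].
  exists (small_cell_moment A (a := a) 2) => [n|]; last exact: S_eq.
  split; first exact: S_open.
  move=> U U0 oU; have [mu [Umu Smu]] := S_dense 2 q2 U U0 oU.
  by exists mu; split => //; move: Smu; rewrite S_eq// => /(_ n I).
move=> mu /=; exact: upper_entropy_dim_pinfty_of_fractal.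
Qed.
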